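(* Let $p>3$ be a prime and, for $n\in\mathbb{N}$, let $A_n=\sum_{k=0}^n\binom{n}{k}^2\binom{n+k}{k}^2$ be the Apéry numbers. Then $$\frac1p\sum_{k=0}^{p-1}(-1)^k(2k+1)A_k\equiv \left(\frac{p}{3}\right)+\frac{p^2}{6}B_{p-2}\left(\frac13\right)\pmod{p^3}.$$
   Context: $\left(\frac{\cdot}{3}\right)$ denotes the Legendre symbol. $B_n(x)=\sum_{k=0}^n\binom nk B_k x^{n-k}$ is the $n$th Bernoulli polynomial, where $B_k$ are the Bernoulli numbers. Congruences between rational numbers are understood in the ring of rationals whose denominators are coprime to $p$: $a\equiv b\pmod{p^m}$ means $(a-b)/p^m$ is such a rational. *)

(* Defs.v *)
From mathcomp Require Import all_boot all_order all_algebra.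
Set Implicit Arguments. Unset Strict Implicit. Unset Printing Implicit Defensive.
Import Order.TTheory GRing.Theory Num.Theory.
Local Open Scope ring_scope.

(* bern_seq n = [:: B_0; ...; B_n], via B_0 = 1 and
   B_n = -1/(n+1) * sum_{k<n} C(n+1,k) B_k  (convention B_1 = -1/2). *)
Fixpoint bern_seq (n : nat) : seq rat :=
  match n with
  | 0 => [:: 1]
  | n'.+1 => let s := bern_seq n' in
      rcons s (- (n'.+2%:R)^-1 * \sum_(k < n'.+1) ('C(n'.+2, k))%:R * nth 0 s k)
  end.

Definition bernoulli (n : nat) : rat := nth 0 (bern_seq n) n.

Definition bernpoly (n : nat) (x : rat) : rat :=
  \sum_(k < n.+1) ('C(n, k))%:R * bernoulli k * x ^+ (n - k).

Definition apery (n : nat) : nat :=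
  (\sum_(k < n.+1) 'C(n, k) ^ 2 * 'C(n + k, k) ^ 2)%N.

Definition legendre3 (p : nat) : rat :=
  if (p %% 3 == 1)%N then 1 else if (p %% 3 == 2)%N then -1 else 0.

(* a = b (mod p^m) in the ring of rationals with denominator coprime to p. *)
Definition ratcong (p m : nat) (a b : rat) : Prop :=
  coprime p `|denq ((a - b) / (p%:R ^+ m))|%N.

(* Main.v *)
Require Import Defs.
From mathcomp Require Import all_boot all_order all_algebra.
From mathcomp Require Import ring lra zify.
Import Order.TTheory GRing.Theory Num.Theory.
Local Open Scope ring_scope.

(** Write c_k = C(2k,k), H_m = sum_{i<=m} 1/i^2, chi = (./3) and
    e(d) = (-1)^(d-1) chi(d), a sequence of period 6 coming from the primitive
    sixth roots of unity w, for which 1 - w = 1/w.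

    Expanding C(n,k)^2 C(n+k,k)^2 in the basis C(n,m) C(n+m,m) and summing over
    n turns the left-hand side into
      S = sum_{k<p} c_k sum_m C(m,k) C(k,m-k) C(p-1,m) C(p+m,m).
    Modulo p^3 the product C(p-1,m) C(p+m,m) may be replaced by
    (-1)^m (1 - p^2 H_m), and the inner sum by some u_k with
    u_k - u_(k-1) = -3p^2/(k^2 c_k) and u_(p-1) = 1 (mod p^3). Summation by
    parts, together with sum_{k<n} c_k = sum_d chi(d) C(2n,n+d), then gives
      S = chi(p) - z/2 (mod p^3),  z = sum_{0<d<p} chi(d) C(2p,p+d).
    By Vandermonde z/p^2 is an integer, congruent mod p to
    -2 sum_d e(d) (1 + 1/2 + ... + 1/d)/d; the invariance of e under the
    binomial transform makes this -4 sum_d e(d)/d^2. Finally B_{p-2}, as a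
    function on F_p, is determined by B(x+1) - B(x) = -2/x^2 and B(0) = 0, and
    its reflection and duplication formulas give
    sum_d e(d)/d^2 = B(1/3)/12. *)

(** * Expansion of the squared Apery factors *)

(** The subtraction takes place in the ring, so truncation never enters; for n < m both binomials
    vanish. *)
Lemma bin_leftR (R : comPzRingType) (n m : nat) :
  m.+1%:R * 'C(n, m.+1)%:R = (n%:R - m%:R) * 'C(n, m)%:R :> R.
Proof.
have [le_mn|lt_nm] := leqP m n; last by rewrite !bin_small ?mulr0 // ltnW.
by rewrite -natrB // -!natrM mul_bin_left.
Qed.

Lemma bin_diagR (R : comPzRingType) (n m : nat) :
  n.+1%:R * 'C(n, m)%:R = m.+1%:R * 'C(n.+1, m.+1)%:R :> R.
Proof. by rewrite -!natrM (mul_bin_diag n.+1). Qed.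

Lemma bin_downR (R : comPzRingType) (n m : nat) :
  n.+1%:R * 'C(n, m)%:R = (n.+1%:R - m%:R) * 'C(n.+1, m)%:R :> R.
Proof.
have [le_mn|lt_nm] := leqP m n.+1.
  by rewrite -natrB // -!natrM (mul_bin_down n.+1).
by rewrite !bin_small ?mulr0 // ltnW.
Qed.

Lemma bin_trinomial (n m k : nat) : (k <= m <= n)%N ->
  ('C(n, m) * 'C(m, k) = 'C(n, k) * 'C(n - k, m - k))%N.
Proof.
case/andP=> le_km le_mn; have le_kn := leq_trans le_km le_mn.
have e1 := bin_fact le_mn; have e2 := bin_fact le_km.
have e3 := bin_fact le_kn; have e4 := bin_fact (leq_sub2r k le_mn).
rewrite subnBA // subnK // in e4.
have gt0 : (0 < k`! * ((m - k)`! * (n - m)`!))%N by rewrite !muln_gt0 !fact_gt0.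
apply/eqP; rewrite -(eqn_pmul2r gt0); apply/eqP.
transitivity ('C(n, m) * ('C(m, k) * (k`! * (m - k)`!) * (n - m)`!))%N; first by ring.
rewrite e2 e1 -e3 -e4; ring.
Qed.

Lemma natrS_neq0 (n : nat) : n.+1%:R != 0 :> rat.
Proof. by rewrite pnatr_eq0. Qed.

(** As a function of n this is the product of n(n+1) - i(i+1) over i < l, divided by l!^2: a
    polynomial of degree l in n(n+1). *)
Definition apery_factor (n l : nat) : rat := 'C(n, l)%:R * 'C(n + l, l)%:R.

Lemma apery_factorS (n l : nat) :
  l.+1%:R ^+ 2 * apery_factor n l.+1 =
  (n%:R - l%:R) * (n%:R + l%:R + 1) * apery_factor n l.
Proof.
have h1 := bin_leftR rat n l; have h2 := bin_diagR rat (n + l) l.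
rewrite /apery_factor addnS.
transitivity ((l.+1%:R * 'C(n, l.+1)%:R) *
              (l.+1%:R * 'C((n + l).+1, l.+1)%:R) : rat); first by ring.
rewrite h1 -h2 -[(n + l).+1]addn1 !natrD; ring.
Qed.

(** The factors form a basis of the polynomials in n(n+1), and this linearizes their products.
    Induction on l multiplies both sides by n(n+1) - l(l+1) and compares coefficients. *)
Lemma apery_factor_mul (n k l : nat) :
  apery_factor n k * apery_factor n l =
  \sum_(0 <= m < (k + l).+1)
    ('C(k + l, m) * 'C(m, k) * 'C(m, l))%:R * apery_factor n m.
Proof.
elim: l => [|l IHl].
  rewrite addn0 big_nat_recr //= big_nat big1 ?add0r => [|m /andP[_ ltmk]].
    by rewrite !binn !bin0 /apery_factor !bin0; ring.
  by rewrite (bin_small ltmk) muln0 mul0n mul0r.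
apply: (mulfI (expf_neq0 2 (natrS_neq0 l))).
rewrite mulrCA apery_factorS mulrCA IHl mulr_sumr.
set a := fun m => ('C(k + l, m) * 'C(m, k) * 'C(m, l))%:R : rat.
(* Since (n-l)(n+l+1) = (n-m)(n+m+1) + (m-l)(m+l+1), each term splits into one that raises m and one
   that keeps it. *)
transitivity (\sum_(0 <= m < (k + l).+1)
   (a m * m.+1%:R ^+ 2 * apery_factor n m.+1 +
    a m * (m%:R - l%:R) * (m%:R + l%:R + 1) * apery_factor n m)).
  by apply: eq_bigr => m _; rewrite -[a m * _ * apery_factor n m.+1]mulrA apery_factorS /a; ring.
rewrite big_split /=.
have -> : \sum_(0 <= m < (k + l).+1) a m * (m%:R - l%:R) * (m%:R + l%:R + 1) * apery_factor n m
  = \sum_(0 <= m < (k + l).+2) a m * (m%:R - l%:R) * (m%:R + l%:R + 1) * apery_factor n m.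
  by rewrite [RHS]big_nat_recr //= /a bin_small // !mul0r addr0.
rewrite [X in _ + X]big_nat_recl // /=.
rewrite addnS [in RHS]big_nat_recl // [RHS]mulrDr [X in _ = _ + X]mulr_sumr addrCA -big_split /=.
congr (_ + _).
  rewrite /a !bin0n; case: l {IHl a} => [|l]; last by rewrite !muln0 !mul0r mulr0.
  by rewrite subrr mulr0 muln0 !mul0r mulr0.
apply: eq_bigr => m _; rewrite [RHS]mulrA -mulrDl; congr (_ * _).
rewrite /a !natrM binS natrD.
have h1 := bin_leftR rat (k + l) m; have h2 := bin_leftR rat m.+1 l.
have h3 := bin_downR rat m k; have h4 := bin_downR rat m l.
set x := 'C(k + l, m)%:R in h1 *; set x' := 'C(k + l, m.+1)%:R in h1 *.
transitivity (x * (m.+1%:R * 'C(m, k)%:R) * (m.+1%:R * 'C(m, l)%:R) +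
   x' * 'C(m.+1, k)%:R * 'C(m.+1, l)%:R *
   (m.+1%:R - l%:R) * (m%:R + l%:R + 2)); first by ring.
rewrite h3 h4.
transitivity ((l.+1%:R * 'C(m.+1, l.+1)%:R) * l.+1%:R * (x' + x) * 'C(m.+1, k)%:R); last by ring.
rewrite h2.
move: h1; rewrite natrD => h1.
(* The two sides of the goal differ by [h1] times this cofactor. *)
have : (m.+1%:R * x' - (k%:R + l%:R - m%:R) * x) * ('C(m.+1, k)%:R * 'C(m.+1, l)%:R *
   (m.+1%:R - l%:R)) = 0 by rewrite h1 subrr mul0r.
move=> h; apply/eqP; rewrite -subr_eq0 -h; apply/eqP; ring.
Qed.

Lemma apery_factor_sqr (n k : nat) :
  apery_factor n k ^+ 2 =
  \sum_(0 <= m < (k + k).+1)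
    ('C(k + k, k) * ('C(m, k) * 'C(k, m - k)))%:R * apery_factor n m.
Proof.
rewrite expr2 apery_factor_mul; apply: eq_big_nat => m /andP[_ ltm].
congr (_%:R * _).
have [ltmk|lekm] := ltnP m k; first by rewrite (bin_small ltmk) !(mul0n, muln0).
by rewrite bin_trinomial ?addnK ?lekm //; ring.
Qed.

(** Telescopes in n. The factor n cancels the division by p in the theorem, and the sign is 1 for
    odd n. *)
Lemma alternating_apery_factor_sum (n m : nat) :
  \sum_(0 <= k < n) (-1) ^+ k * (2 * k + 1)%:R * apery_factor k m =
  (-1) ^+ n.-1 * n%:R * ('C(n.-1, m)%:R * 'C(n + m, m)%:R) :> rat.
Proof.
elim: n => [|n IHn]; first by rewrite big_nil mulr0 mul0r.
rewrite big_nat_recr //= IHn /apery_factor.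
have h1 : n.+1%:R * 'C(n.+1 + m, m)%:R = (n%:R + 1 + m%:R) * 'C(n + m, m)%:R :> rat.
  rewrite addSn; transitivity (((n + m).+1%:R - m%:R) * 'C((n + m).+1, m)%:R : rat).
    by rewrite -!natr1 natrD; ring.
  by rewrite -bin_downR -natr1 natrD; ring.
case: n h1 {IHn} => [|n] h1 /=.
  by case: m {h1} => [|m]; rewrite !bin0n ?bin0 /=; ring.
have h2 := bin_downR rat n m.
rewrite [(-1) ^+ n.+1]exprS natrD natrM.
transitivity ((-1) ^+ n * ((n.+1%:R * 'C(n, m)%:R) * 'C(n.+1 + m, m)%:R -
  (2 * n.+1%:R + 1) * ('C(n.+1, m)%:R * 'C(n.+1 + m, m)%:R)) : rat); first by ring.
rewrite h2.
transitivity (- (-1) ^+ n * ('C(n.+1, m)%:R * (n.+2%:R * 'C(n.+2 + m, m)%:R)) : rat); last by ring.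
by rewrite h1; ring.
Qed.

Lemma apery_sum (p : nat) : odd p ->
  (p%:R)^-1 * \sum_(0 <= k < p) (-1) ^+ k * (2 * k + 1)%:R * (apery k)%:R =
  \sum_(0 <= l < p) 'C(l + l, l)%:R * \sum_(0 <= m < p + p)
     ('C(m, l) * 'C(l, m - l))%:R * ('C(p.-1, m)%:R * 'C(p + m, m)%:R) :> rat.
Proof.
move=> odd_p; have p_gt0 : (0 < p)%N by case: p odd_p.
have p_neq0 : p%:R != 0 :> rat by rewrite pnatr_eq0 -lt0n.
apply: (mulfI p_neq0); rewrite mulrA divff // mul1r.
transitivity (\sum_(0 <= k < p) \sum_(0 <= l < p) \sum_(0 <= m < p + p)
   'C(l + l, l)%:R * ('C(m, l) * 'C(l, m - l))%:R *
   ((-1) ^+ k * (2 * k + 1)%:R * apery_factor k m)).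
  apply: eq_big_nat => k /andP[_ lt_kp].
  have -> : (apery k)%:R = \sum_(0 <= l < p) apery_factor k l ^+ 2 :> rat.
    (* Terms with l > k vanish, so l may run up to p for every k; likewise m <= 2l < 2p gives the
       common range of m. *)
    rewrite /apery natr_sum (big_cat_nat (leq0n k.+1)) //= [X in _ + X]big_nat.
    rewrite [X in _ + X]big1 ?addr0 => [|l /andP[lt_kl _]]; last first.
      by rewrite /apery_factor bin_small // mul0r expr0n.
    rewrite big_mkord; apply: eq_bigr => l _.
    by rewrite natrM !natrX -exprMn.
  rewrite mulr_sumr; apply: eq_big_nat => l /andP[_ lt_lp].
  rewrite apery_factor_sqr mulr_sumr [RHS](big_cat_nat (leq0n (l + l).+1)); last lia.
  rewrite [X in _ = _ + X]big_nat [X in _ = _ + X]big1 ?addr0; last first.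
    move=> m /andP[lt_m _]; rewrite (@bin_small l (m - l)); last lia.
    by rewrite muln0 mulr0 mul0r.
  by apply: eq_bigr => m _; rewrite (natrM _ 'C(l + l, l)); ring.
rewrite exchange_big mulr_sumr; apply: eq_bigr => l _.
rewrite exchange_big !mulr_sumr; apply: eq_bigr => m _.
rewrite -mulr_sumr alternating_apery_factor_sum.
have -> : (-1) ^+ p.-1 = 1 :> rat.
  by rewrite -signr_odd; case: p odd_p {p_gt0 p_neq0} => //= n /negbTE->.
ring.
Qed.

(** * Finite differences *)

(** With E the shift operator, this is ((1 - E)^k f)(n). *)
Definition bin_diff {R : comPzRingType} (f : nat -> R) (k n : nat) : R :=
  \sum_(0 <= i < k.+1) (-1) ^+ i * 'C(k, i)%:R * f (n + i)%N.

Lemma eq_bin_diff (R : comPzRingType) (f g : nat -> R) (k n : nat) :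
  f =1 g -> bin_diff f k n = bin_diff g k n.
Proof. by move=> fg; apply: eq_bigr => i _; rewrite fg. Qed.

Lemma bin_diff0 (R : comPzRingType) (f : nat -> R) n : bin_diff f 0 n = f n.
Proof. by rewrite /bin_diff big_nat1 addn0 !mul1r. Qed.

Lemma bin_diffZ (R : comPzRingType) (c : R) (f : nat -> R) (k n : nat) :
  bin_diff (fun i => c * f i) k n = c * bin_diff f k n.
Proof. by rewrite /bin_diff mulr_sumr; apply: eq_bigr => i _; ring. Qed.

Lemma bin_diffB (R : comPzRingType) (f g : nat -> R) (k n : nat) :
  bin_diff (fun i => f i - g i) k n = bin_diff f k n - bin_diff g k n.
Proof. by rewrite /bin_diff -sumrB; apply: eq_bigr => i _; ring. Qed.

Lemma bin_diffS (R : comPzRingType) (f : nat -> R) (k n : nat) :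
  bin_diff f k.+1 n = bin_diff f k n - bin_diff f k n.+1.
Proof.
rewrite /bin_diff big_nat_recl // [X in _ = X - _]big_nat_recl // !bin0.
rewrite -addrA; congr (_ + _).
transitivity (\sum_(0 <= i < k.+1) (-1) ^+ i.+1 * 'C(k, i.+1)%:R * f (n + i.+1)%N
   - \sum_(0 <= i < k.+1) (-1) ^+ i * 'C(k, i)%:R * f (n.+1 + i)%N).
  rewrite -sumrB; apply: eq_bigr => i _.
  by rewrite binS natrD addSnnS exprS; ring.
by congr (_ - _); rewrite big_nat_recr //= bin_small // mulr0 mul0r addr0.
Qed.

Lemma bin_diff_shift (R : comPzRingType) (f : nat -> R) (k n : nat) :
  bin_diff f k n.+1 = bin_diff (fun i => f i.+1) k n.
Proof. by apply: eq_bigr => i _; rewrite addSn. Qed.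

(** C(i,l) has degree l in i, and by Pascal's rule each difference lowers the degree by one. *)
Lemma bin_diff_bin (R : comPzRingType) (l k n : nat) :
  (l < k)%N -> bin_diff (fun i => 'C(i, l)%:R) k n = 0 :> R.
Proof.
elim: k l n => // k IHk [|l] n lt_lk.
  rewrite bin_diffS bin_diff_shift; apply/eqP; rewrite subr_eq0; apply/eqP.
  by apply: eq_bin_diff => i; rewrite !bin0.
rewrite bin_diffS bin_diff_shift -bin_diffB.
rewrite (@eq_bin_diff _ _ (fun i => -1 * 'C(i, l)%:R)) => [|i].
  by rewrite bin_diffZ IHk // mulr0.
by rewrite binS natrD; ring.
Qed.

(** Both sides equal the beta integral of x^n (1-x)^k over [0,1]; the proof is by induction on k. *)
Lemma bin_diff_inv (k n : nat) :
  bin_diff (fun i => i.+1%:R^-1) k n = (n.+1%:R * 'C(n.+1 + k, k)%:R)^-1 :> rat.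
Proof.
elim: k n => [|k IHk] n; first by rewrite bin_diff0 bin0 mulr1.
rewrite bin_diffS !IHk addnS addSn.
have h1 := bin_leftR rat (n + k).+2 k; have h2 := bin_downR rat (n + k).+1 k.
have n1 := natrS_neq0 n; have n2 := natrS_neq0 n.+1; have k1 := natrS_neq0 k.
have n3 := natrS_neq0 (n + k).+1.
have c1 : 'C((n + k).+1, k)%:R != 0 :> rat by rewrite pnatr_eq0 -lt0n bin_gt0; lia.
have e2 : 'C((n + k).+2, k)%:R = (n + k).+2%:R * 'C((n + k).+1, k)%:R / n.+2%:R :> rat.
  apply: (canRL (mulfK n2)); rewrite h2 mulrC; congr (_ * _).
  by rewrite -!natr1 ?natrD; ring.
have e1 : 'C((n + k).+2, k.+1)%:R = (n + k).+2%:R * 'C((n + k).+1, k)%:R / k.+1%:R :> rat.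
  apply: (canRL (mulfK k1)); rewrite mulrC h1 e2 -!natr1 ?natrD; field.
  by rewrite !natr1 natrS_neq0.
rewrite addSn e1 e2.
move: n1 n2 k1 n3 c1; rewrite -!natr1 ?natrD => n1 n2 k1 n3 c1.
by field; rewrite k1 c1 n3 n1 n2.
Qed.

(** C(i,l+1)/(i+1) = C(i,l)/(l+1) - C(i,l)/(i+1), and the first part is killed by the difference, so
    raising l only flips the sign. *)
Lemma bin_diff_bin_inv (l k n : nat) : (l <= k)%N ->
  bin_diff (fun i => 'C(i, l)%:R / i.+1%:R) k n =
  (-1) ^+ l / (n.+1%:R * 'C(n.+1 + k, k)%:R) :> rat.
Proof.
elim: l => [|l IHl] lt_lk.
  rewrite mul1r -bin_diff_inv; apply: eq_bin_diff => i; by rewrite bin0 mul1r.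
rewrite exprS -mulrA -(IHl (ltnW lt_lk)).
rewrite (@eq_bin_diff _ _ (fun i => l.+1%:R^-1 * 'C(i, l)%:R - 'C(i, l)%:R / i.+1%:R)) => [|i].
  by rewrite bin_diffB bin_diffZ bin_diff_bin // mulr0; ring.
have h := bin_leftR rat i l; have i1 := natrS_neq0 i; have l1 := natrS_neq0 l.
have -> : 'C(i, l.+1)%:R = (i%:R - l%:R) * 'C(i, l)%:R / l.+1%:R :> rat.
  by apply: (canRL (mulfK l1)); rewrite mulrC.
move: i1 l1; rewrite -!natr1 ?natrD => i1 l1.
by field; rewrite i1 l1.
Qed.

(** * The signed inner sums u_k and their recurrence *)

(** The sign comes from C(p-1,m) C(p+m,m), which is (-1)^m to leading order; the support is k <= m
    <= 2k. *)
Definition wgt (k m : nat) : rat := (-1) ^+ m * ('C(m, k) * 'C(k, m - k))%:R.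

Lemma wgt_small k m : (m < k)%N -> wgt k m = 0.
Proof. by move=> h; rewrite /wgt bin_small // mul0n mulr0. Qed.

Lemma wgt_large k m : (k + k < m)%N -> wgt k m = 0.
Proof. by move=> h; rewrite /wgt (@bin_small k) ?muln0 ?mulr0 //; lia. Qed.

(* The factor [3 - 2 m / k.+1] is a certificate found by Gosper's algorithm. *)
Lemma wgt_diff (k m : nat) :
  let g m := (3 - 2 * m%:R / k.+1%:R) * wgt k.+1 m in
  wgt k.+1 m - wgt k m = g m.+1 - g m.
Proof.
rewrite /=; have k1 := natrS_neq0 k.
have [lt_mk|] := ltnP m k; first by rewrite !wgt_small ?(leq_trans lt_mk) //; ring.
rewrite leq_eqVlt => /orP[/eqP <-|].
  rewrite (wgt_small _ _ (ltnSn k)) /wgt !binn !subnn !bin0 exprS.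
  by move: k1; rewrite -!natr1 ?natrD => k1; field.
move=> /subnKC; set j := (m - k.+1)%N => <-; move: j => j {m}.
rewrite /wgt addSn -addSn -addnS ![(_ + _.+1 - _)%N]addKn addKn.
have -> : (k.+1 + j - k = j.+1)%N by rewrite addSnnS addKn.
rewrite !addSn !addnS !natrM.
have h1 := bin_downR rat k j.+1; have h2 := bin_leftR rat k.+1 j.
have h3 := bin_leftR rat (k + j).+1 k; have h4 := bin_downR rat (k + j).+1 k.+1.
have j1 := natrS_neq0 j.
have e2 : 'C(k.+1, j.+1)%:R = (k%:R + 1 - j%:R) * 'C(k.+1, j)%:R / j.+1%:R :> rat.
  by apply: (canRL (mulfK j1)); rewrite mulrC h2 -!natr1 ?natrD; ring.
have e1 : 'C(k, j.+1)%:R = (k%:R - j%:R) * 'C(k.+1, j.+1)%:R / k.+1%:R :> rat.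
  by apply: (canRL (mulfK k1)); rewrite mulrC h1 -!natr1 ?natrD; ring.
have e3 : 'C((k + j).+1, k)%:R = k.+1%:R * 'C((k + j).+1, k.+1)%:R / j.+1%:R :> rat.
  apply: (canRL (mulfK j1)); rewrite h3 mulrC -!natr1 ?natrD; ring.
have e4 : 'C((k + j).+2, k.+1)%:R = (k + j).+2%:R * 'C((k + j).+1, k.+1)%:R / j.+1%:R :> rat.
  apply: (canRL (mulfK j1)); rewrite h4 mulrC -!natr1 ?natrD; ring.
rewrite e1 e2 e3 e4 !exprS.
move: k1 j1; rewrite -!natr1 ?natrD => k1 j1.
by field; rewrite k1 j1.
Qed.

Lemma sum_by_parts (R : comPzRingType) (f g : nat -> R) (n : nat) :
  \sum_(0 <= i < n) (g i.+1 - g i) * f i =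
  g n * f n - g 0%N * f 0%N - \sum_(0 <= i < n) g i.+1 * (f i.+1 - f i).
Proof.
elim: n => [|n IHn]; first by rewrite !big_nil; ring.
by rewrite !big_nat_recr //= IHn; ring.
Qed.

Definition harm2 (n : nat) : rat := \sum_(0 <= i < n) (i.+1%:R ^+ 2)^-1.

Lemma harm2S n : harm2 n.+1 = harm2 n + (n.+1%:R ^+ 2)^-1.
Proof. by rewrite /harm2 big_nat_recr. Qed.

Lemma big_nat_widen_zero (V : nmodType) (F : nat -> V) (m n : nat) :
  (m <= n)%N -> (forall i, (m <= i)%N -> F i = 0) ->
  \sum_(0 <= i < n) F i = \sum_(0 <= i < m) F i.
Proof.
move=> le_mn F0; rewrite (big_cat_nat (leq0n m)) //= [X in _ + X]big_nat.
by rewrite [X in _ + X]big1 ?addr0 // => i /andP[/F0].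
Qed.

(** Writing the index as k+1+i turns the factor C(k+1,m-k-1) at m = k+1+i into C(k+1,i), the
    coefficients of a difference of order k+1. *)
Lemma wgt_shift_sum (k M : nat) (f : nat -> rat) : (k.+1 + k.+1 < M)%N ->
  \sum_(0 <= m < M) wgt k.+1 m.+1 * f m.+1 =
  (-1) ^+ k.+1 * bin_diff (fun i => 'C(i.+1, k.+1)%:R * f i.+1) k.+1 k.
Proof.
move=> lt_M; rewrite (@big_nat_widen_zero _ _ (k + k.+2)) => [||i le_i].
- rewrite (big_cat_nat (leq0n k)) //=; last lia.
  rewrite [X in X + _]big_nat [X in X + _]big1 ?add0r => [|i /andP[_ lt_ik]]; last first.
    by rewrite wgt_small ?mul0r.
  rewrite -[X in \big[_/_]_(X <= _ < _) _]add0n big_addn addKn /bin_diff mulr_sumr.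
  apply: eq_bigr => i _; rewrite /wgt natrM.
  have -> : ((i + k).+1 - k.+1 = i)%N by rewrite subSS addnK.
  by rewrite [(k + i)%N]addnC -{1}addnS exprD; ring.
- lia.
by rewrite wgt_large ?mul0r //; lia.
Qed.

Lemma wgt_inv_sum (k M : nat) : (k.+1 + k.+1 < M)%N ->
  \sum_(0 <= m < M) wgt k.+1 m.+1 / m.+1%:R = 0.
Proof.
move=> lt_M; rewrite (@wgt_shift_sum k M (fun m => m%:R^-1)) //.
(* C(i+1,k+1)/(i+1) = C(i,k)/(k+1) has degree k, below the order k+1 of the difference. *)
rewrite (@eq_bin_diff _ _ (fun i => k.+1%:R^-1 * 'C(i, k)%:R)) => [|i].
  by rewrite bin_diffZ bin_diff_bin // !mulr0.
have h := bin_diagR rat i k; have i1 := natrS_neq0 i; have k1 := natrS_neq0 k.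
by apply: (canLR (mulfK i1)); rewrite -mulrA [_ * i.+1%:R]mulrC h mulKf.
Qed.

Lemma wgt_inv2_sum (k M : nat) : (k.+1 + k.+1 < M)%N ->
  \sum_(0 <= m < M) wgt k.+1 m.+1 / m.+1%:R ^+ 2 =
  - (k.+1%:R ^+ 2 * 'C(k.+1 + k.+1, k.+1)%:R)^-1.
Proof.
move=> lt_M; rewrite (@wgt_shift_sum k M (fun m => (m%:R ^+ 2)^-1)) //.
rewrite (@eq_bin_diff _ _ (fun i => k.+1%:R^-1 * ('C(i, k)%:R / i.+1%:R))) => [|i].
  rewrite bin_diffZ bin_diff_bin_inv // exprS -[k.+1%:R ^+ 2]/(k.+1%:R * k.+1%:R).
  transitivity (- ((-1) ^+ k * (-1) ^+ k) / (k.+1%:R * (k.+1%:R * 'C(k.+1 + k.+1, k.+1)%:R)) : rat).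
    by rewrite !invfM; ring.
  by rewrite -expr2 sqrr_sign mulN1r mulrA.
have h := bin_diagR rat i k; have i1 := natrS_neq0 i; have k1 := natrS_neq0 k.
have -> : 'C(i.+1, k.+1)%:R = i.+1%:R * 'C(i, k)%:R / k.+1%:R :> rat.
  by apply: (canRL (mulfK k1)); rewrite h mulrC.
by field; rewrite !nat1r i1 k1.
Qed.

(* The sum u_k of the header is [wgt_sum (p ^+ 2) k M], for any M > 2k. *)
Definition wgt_sum (x : rat) (k M : nat) : rat :=
  \sum_(0 <= m < M) wgt k m * (1 - x * harm2 m).

Lemma wgt_sumS x k M : (k.+1 + k.+1 < M)%N ->
  wgt_sum x k.+1 M = wgt_sum x k M - 3 * x / (k.+1%:R ^+ 2 * 'C(k.+1 + k.+1, k.+1)%:R).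
Proof.
move=> lt_M; apply/eqP; rewrite addrC -subr_eq; apply/eqP.
rewrite /wgt_sum -sumrB.
pose g m := (3 - 2 * m%:R / k.+1%:R) * wgt k.+1 m.
under eq_bigr => m _ do rewrite -mulrBl (wgt_diff k m) -/(g m.+1) -/(g m).
(* The difference moves onto 1 - x H_m, whose increment is -x/(m+1)^2. Against the certificate this
   leaves the sums of [wgt] over m and over m^2; both boundary terms vanish. *)
rewrite sum_by_parts.
have -> : g M = 0 by rewrite /g wgt_large ?mulr0.
have -> : g 0%N = 0 by rewrite /g wgt_small ?mulr0.
have h1 := wgt_inv_sum _ _ lt_M; have h2 := wgt_inv2_sum _ _ lt_M.
transitivity (x * (3 * (\sum_(0 <= m < M) wgt k.+1 m.+1 / m.+1%:R ^+ 2) -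
   2 / k.+1%:R * \sum_(0 <= m < M) wgt k.+1 m.+1 / m.+1%:R)); last first.
  by rewrite h1 h2; ring.
rewrite !mul0r subrr sub0r -sumrN !mulr_sumr -sumrB mulr_sumr.
apply: eq_bigr => m _; rewrite harm2S /g.
have m1 := natrS_neq0 m; have k1 := natrS_neq0 k.
by field; rewrite !nat1r m1 k1.
Qed.

(** Summation by parts against the partial sums of c_k, the increments of [wgt_sum] coming from
    [wgt_sumS]. *)
Lemma central_bin_sum (x : rat) (n M : nat) : (n + n < M)%N ->
  \sum_(0 <= k < n.+1) 'C(k + k, k)%:R * wgt_sum x k M =
  wgt_sum x n M * (\sum_(0 <= k < n.+1) 'C(k + k, k)%:R) +
  3 * x * \sum_(0 <= i < n)
    (\sum_(0 <= k < i.+1) 'C(k + k, k)%:R) / (i.+1%:R ^+ 2 * 'C(i.+1 + i.+1, i.+1)%:R).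
Proof.
elim: n => [|n IHn] lt_M; first by rewrite !big_nat1 big_nil; ring.
rewrite big_nat_recr //= IHn; last lia.
by rewrite wgt_sumS // [in RHS]big_nat_recr //= [in X in _ = _ + X]big_nat_recr //=; ring.
Qed.

(** * Sums of central binomial coefficients *)

Lemma legendre3_sum n : legendre3 n + legendre3 n.+1 + legendre3 n.+2 = 0.
Proof.
rewrite /legendre3; have : (n %% 3 < 3)%N by rewrite ltn_mod.
rewrite -[n.+2]addn2 -[n.+1]addn1 -(modnDml n 1) -(modnDml n 2).
by case: (n %% 3)%N => [|[|[|]]].
Qed.

(** Collected by values of f, interior coefficients are sums of three consecutive characters, hence
    zero. *)
Lemma legendre3_weighted_sum (f : nat -> rat) (n : nat) :
  \sum_(0 <= d < n) legendre3 d.+1 * (f d.+2 + f d.+1 + f d) =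
  f 0%N - legendre3 n.+1 * f n + legendre3 n * f n.+1.
Proof.
elim: n => [|n IHn]; first by rewrite big_nil /legendre3 /=; ring.
rewrite big_nat_recr //= IHn.
have -> : legendre3 n.+2 = - legendre3 n - legendre3 n.+1.
  by have := legendre3_sum n; lra.
ring.
Qed.

(** With f d = C(2n,n+d), Pascal's rule applied twice makes the increment in n equal to the weighted
    sum of f(d+2) + f(d+1) + f(d), which collapses to f(0). The bound M stays fixed through the
    induction. *)
Lemma sum_central_bin (n M : nat) : (n <= M)%N ->
  \sum_(0 <= k < n) 'C(k + k, k)%:R =
  \sum_(0 <= d < M) legendre3 d.+1 * 'C(n + n, n + d.+1)%:R.
Proof.
elim: n => [|n IHn] le_nM; first by rewrite big_nil big1 // => i _; rewrite bin0n mulr0.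
rewrite big_nat_recr //= IHn; last exact: ltnW.
have := legendre3_weighted_sum (fun d => 'C(n + n, n + d)%:R) M.
rewrite addn0 (@bin_small _ (n + M)) ?(@bin_small _ (n + M.+1)); try lia.
rewrite !mulr0 subr0 addr0.
move=> <-; rewrite -big_split; apply: eq_bigr => d _ /=.
by rewrite !addSn !addnS !binS !natrD; ring.
Qed.

Lemma central_bin_ratio (n d : nat) :
  (n.+1%:R ^+ 2 - d%:R ^+ 2) * 'C(n.+1 + n.+1, n.+1 + d)%:R =
  (n + n).+2%:R * (n + n).+1%:R * 'C(n + n, n + d)%:R :> rat.
Proof.
have h1 := bin_diagR rat (n + n).+1 (n + d); have h2 := bin_downR rat (n + n) (n + d).
rewrite -[RHS]mulrA h2 mulrCA h1 addSn addnS addSn -!natr1 !natrD; ring.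
Qed.

Lemma central_bin_neq0 n : 'C(n + n, n)%:R != 0 :> rat.
Proof. by rewrite pnatr_eq0 -lt0n bin_gt0 leq_addr. Qed.

Lemma central_bin_quot (n d : nat) :
  'C(n + n, n + d)%:R / 'C(n + n, n)%:R =
  (n.+1%:R ^+ 2 - d%:R ^+ 2) * 'C(n.+1 + n.+1, n.+1 + d)%:R /
  (n.+1%:R ^+ 2 * 'C(n.+1 + n.+1, n.+1)%:R) :> rat.
Proof.
have h0 := central_bin_ratio n 0; rewrite !addn0 expr0n subr0 in h0.
have n2 : (n + n).+2%:R * (n + n).+1%:R != 0 :> rat by rewrite mulf_neq0 ?natrS_neq0.
by rewrite central_bin_ratio h0 -mulf_div divff // mul1r.
Qed.

(** Put R_n(d) = C(2n,n+d)/C(2n,n). By [central_bin_quot], R_(n+1)(d) - R_n(d) = d^2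
    R_(n+1)(d)/(n+1)^2; this cancels 1/d^2, and [sum_central_bin] applies. *)
Lemma sum_central_bin_ratio (n M : nat) : (n <= M)%N ->
  \sum_(0 <= i < n) (\sum_(0 <= k < i.+1) 'C(k + k, k)%:R) /
     (i.+1%:R ^+ 2 * 'C(i.+1 + i.+1, i.+1)%:R) =
  (\sum_(0 <= d < M) legendre3 d.+1 / d.+1%:R ^+ 2 * 'C(n + n, n + d.+1)%:R) /
     'C(n + n, n)%:R.
Proof.
elim: n => [|n IHn] le_nM; first by rewrite big_nil big1 ?mul0r // => i _; rewrite bin0n mulr0.
rewrite big_nat_recr //= IHn; last exact: ltnW.
rewrite (sum_central_bin _ M) // !mulr_suml -big_split; apply: eq_bigr => d _ /=.
have n1 := natrS_neq0 n; have d1 := natrS_neq0 d.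
have c1 := central_bin_neq0 n.+1.
rewrite -[X in X + _]mulrA central_bin_quot.
move: n1 d1 c1; rewrite -!natr1 => n1 d1 c1.
by field; rewrite ?n1 ?d1 ?c1.
Qed.

(** The term d = p gives chi(p), as C(2p,2p) = 1; [central_bin_quot] lifts the correction from level
    p-1 to level p. *)
Lemma weighted_central_bin_sum (n M : nat) (p := n.+1) : (p + p <= M)%N ->
  \sum_(0 <= k < p) 'C(k + k, k)%:R * wgt_sum (p%:R ^+ 2) k M =
  wgt_sum (p%:R ^+ 2) n M *
    (legendre3 p + \sum_(0 <= d < n) legendre3 d.+1 * 'C(p + p, p + d.+1)%:R) +
  3 / 'C(p + p, p)%:R * \sum_(0 <= d < n)
    legendre3 d.+1 * (p%:R ^+ 2 / d.+1%:R ^+ 2 - 1) * 'C(p + p, p + d.+1)%:R.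
Proof.
move=> le_M; rewrite /p central_bin_sum; last by rewrite /p in le_M; lia.
rewrite (sum_central_bin _ n.+1) // (sum_central_bin_ratio _ n.+1) //.
rewrite [X in _ * X + _]big_nat_recr //= binn mulr1 [X in _ * X + _]addrC.
congr (_ + _); rewrite big_nat_recr //= (@bin_small (n + n)); last lia.
rewrite mulr0 addr0 mulr_suml !mulr_sumr; apply: eq_bigr => d _.
have n1 := natrS_neq0 n; have d1 := natrS_neq0 d.
have c1 := central_bin_neq0 n.+1.
rewrite -[_ / _ * _ / 'C(n + n, n)%:R]mulrA central_bin_quot.
move: n1 d1 c1; rewrite -!natr1 => n1 d1 c1.
by field; rewrite ?n1 ?d1 ?c1.
Qed.

(** * Integrality and residues at p *)

Lemma Fp_natr_eq0 (p n : nat) : prime p -> (n%:R == 0 :> 'F_p) = (p %| n)%N.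
Proof. by move=> pr_p; rewrite (dvdn_pcharf (pchar_Fp pr_p)). Qed.

(** A relation rather than a function: any fraction a/b with b prime to p may serve, so closure
    under ring operations requires no reduced form. *)
Definition residue (p : nat) (x : rat) (y : 'F_p) : Prop :=
  exists (a : int) (b : nat),
    [/\ ~~ (p %| b)%N, x * b%:R = a%:~R & y * b%:R = a%:~R].

(** Membership in the localization of the integers at p; [ratcong] unfolds to it. *)
Definition pint (p : nat) (x : rat) : Prop := coprime p `|denq x|%N.

(* Meaningful only for [pint p x]: otherwise the denominator vanishes in ['F_p]. *)
Definition redF (p : nat) (x : rat) : 'F_p := (numq x)%:~R / `|denq x|%N%:R.

Section Residue.
Variables (p : nat) (pr_p : prime p).

Lemma residueD x x' y y' :
  residue p x y -> residue p x' y' -> residue p (x + x') (y + y').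
Proof.
move=> [a [b [nb e1 e2]]] [a' [b' [nb' e1' e2']]].
exists (a * b'%:R + a' * b%:R), (b * b')%N; split; first by rewrite Euclid_dvdM // negb_or nb.
  by rewrite !rmorphD !rmorphM /= -e1 -e1' ?natrM !rmorph_nat; ring.
by rewrite !rmorphD !rmorphM /= -e2 -e2' ?natrM !rmorph_nat; ring.
Qed.

Lemma residueM x x' y y' :
  residue p x y -> residue p x' y' -> residue p (x * x') (y * y').
Proof.
move=> [a [b [nb e1 e2]]] [a' [b' [nb' e1' e2']]].
exists (a * a'), (b * b')%N; split; first by rewrite Euclid_dvdM // negb_or nb.
  by rewrite !rmorphM /= -e1 -e1' ?natrM; ring.
by rewrite !rmorphM /= -e2 -e2' ?natrM; ring.
Qed.

Lemma residue_int (a : int) : residue p a%:~R a%:~R.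
Proof.
exists a, 1%N; split; rewrite ?mulr1 //.
by rewrite dvdn1 neq_ltn prime_gt1 // orbT.
Qed.

Lemma residue_nat (n : nat) : residue p n%:R n%:R.
Proof. exact: (residue_int n). Qed.

Lemma residueN x y : residue p x y -> residue p (- x) (- y).
Proof. by move=> /(residueM _ _ _ _ (residue_int (- 1))); rewrite !mulN1r. Qed.

Lemma residueB x x' y y' :
  residue p x y -> residue p x' y' -> residue p (x - x') (y - y').
Proof. by move=> h h'; apply: residueD => //; exact: residueN. Qed.

Lemma residueX x y n : residue p x y -> residue p (x ^+ n) (y ^+ n).
Proof.
move=> h; elim: n => [|n IHn]; first exact: (residue_nat 1).
by rewrite !exprS; exact: residueM.
Qed.

Lemma residue_natV n : ~~ (p %| n)%N -> residue p n%:R^-1 n%:R^-1.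
Proof.
move=> pn; exists 1, n; split => //; apply: mulVf.
  by apply: contraNneq pn => /eqP; rewrite pnatr_eq0 => /eqP->.
by rewrite Fp_natr_eq0.
Qed.

Lemma residue_sum (f : nat -> rat) (g : nat -> 'F_p) (m n : nat) :
  (forall i, (m <= i < n)%N -> residue p (f i) (g i)) ->
  residue p (\sum_(m <= i < n) f i) (\sum_(m <= i < n) g i).
Proof.
move=> h; rewrite big_nat [X in residue _ _ X]big_nat.
apply: (big_ind2 (residue p)) => //; first exact: (residue_nat 0).
by move=> *; apply: residueD.
Qed.

Lemma residue_pint x y : residue p x y -> pint p x.
Proof.
move=> [a [b [nb e _]]]; rewrite /pint prime_coprime //; apply: contra nb => pd.
have e' : numq x * b%:Z = a * denq x.
  apply: (@intr_inj rat); rewrite !rmorphM /= -e numqE -pmulrn; ring.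
have : (denq x %| numq x * b%:Z)%Z by rewrite e' dvdz_mull.
have cop : coprimez (denq x) (numq x).
  by rewrite coprimezE coprime_sym coprime_num_den.
rewrite (Gauss_dvdzr _ cop) dvdzE /=; exact: dvdn_trans.
Qed.

Lemma redFP x : pint p x -> residue p x (redF p x).
Proof.
rewrite /pint prime_coprime // => nd.
exists (numq x), `|denq x|%N; split => //.
  by rewrite numqE pmulrn absz_denq.
by rewrite mulfVK // Fp_natr_eq0.
Qed.

Lemma pint_residue x : pint p x -> exists y, residue p x y.
Proof. by move=> /redFP; exists (redF p x). Qed.

Lemma residue_inj x y y' : residue p x y -> residue p x y' -> y = y'.
Proof.
move=> h /(residueB _ _ _ _ h); rewrite subrr => -[a [b [nb]]].
rewrite mul0r => /esym/eqP; rewrite intr_eq0 => /eqP-> /eqP.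
by rewrite mulf_eq0 Fp_natr_eq0 // (negbTE nb) orbF subr_eq0 => /eqP.
Qed.

(** The way back from identities in ['F_p] to congruences between rationals. *)
Lemma residue0_pint x : residue p x 0 -> pint p (x / p%:R).
Proof.
move=> [a [b [nb e]]]; rewrite mul0r => /esym/eqP.
have p0 : p%:R != 0 :> rat by rewrite pnatr_eq0 -lt0n prime_gt0.
have -> : (a%:~R == 0 :> 'F_p) = (p %| `|a|)%N.
  rewrite -Fp_natr_eq0 //; case: (intP a) => [|n|n] //=.
  by rewrite rmorphN oppr_eq0.
move=> pa; have /dvdzP[c ac] : (p %| a)%Z by rewrite dvdzE.
apply: (@residue_pint _ (c%:~R / b%:R)); exists c, b; split => //.
  by rewrite mulrAC e ac rmorphM /= -pmulrn mulfK.
by rewrite mulfVK // Fp_natr_eq0.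
Qed.

Lemma pint_nat n : pint p n%:R.
Proof. exact: residue_pint (residue_nat n). Qed.

Lemma pint_int a : pint p a%:~R.
Proof. exact: residue_pint (residue_int a). Qed.

Lemma pint_natV n : ~~ (p %| n)%N -> pint p n%:R^-1.
Proof. by move=> /residue_natV /residue_pint. Qed.

Lemma pintD x y : pint p x -> pint p y -> pint p (x + y).
Proof.
by move=> /pint_residue[a ha] /pint_residue[b hb]; exact: residue_pint (residueD _ _ _ _ ha hb).
Qed.

Lemma pintM x y : pint p x -> pint p y -> pint p (x * y).
Proof.
by move=> /pint_residue[a ha] /pint_residue[b hb]; exact: residue_pint (residueM _ _ _ _ ha hb).
Qed.

Lemma pintN x : pint p x -> pint p (- x).
Proof. by move=> /pint_residue[a ha]; exact: residue_pint (residueN _ _ ha). Qed.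

Lemma pintB x y : pint p x -> pint p y -> pint p (x - y).
Proof. by move=> hx hy; apply: pintD => //; exact: pintN. Qed.

Lemma pintX x n : pint p x -> pint p (x ^+ n).
Proof. by move=> /pint_residue[a ha]; exact: residue_pint (residueX _ _ n ha). Qed.

Lemma pint_sum (f : nat -> rat) (m n : nat) :
  (forall i, (m <= i < n)%N -> pint p (f i)) -> pint p (\sum_(m <= i < n) f i).
Proof.
move=> h; rewrite big_nat; apply: (big_ind (pint p)) => //; first exact: (pint_nat 0).
exact: pintD.
Qed.

End Residue.

(* With p = n.+1, [bin_prod n m] is C(p-1,m) C(p+m,m). *)
Definition bin_prod (n m : nat) : rat := 'C(n, m)%:R * 'C(n.+1 + m, m)%:R.

Lemma bin_prodS (n m : nat) :
  bin_prod n m.+1 = (n.+1%:R ^+ 2 / m.+1%:R ^+ 2 - 1) * bin_prod n m.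
Proof.
have h1 := bin_leftR rat n m; have h2 := bin_diagR rat (n.+1 + m) m.
have m1 := natrS_neq0 m; rewrite /bin_prod addnS.
have -> : 'C(n, m.+1)%:R = (n%:R - m%:R) * 'C(n, m)%:R / m.+1%:R :> rat.
  by apply: (canRL (mulfK m1)); rewrite mulrC.
have -> : 'C((n.+1 + m).+1, m.+1)%:R = (n.+1 + m).+1%:R * 'C(n.+1 + m, m)%:R / m.+1%:R :> rat.
  by apply: (canRL (mulfK m1)); rewrite mulrC.
rewrite -[(n.+1 + m).+1%:R]natr1 natrD; move: m1; rewrite -!natr1 => m1.
by field.
Qed.

(** * Reduction of the Apery sum modulo p^3 *)

Section Congruence.
Variables (n : nat) (pr_p : prime n.+1).
Notation p := n.+1.

Lemma p_neq0 : p%:R != 0 :> rat. Proof. exact: natrS_neq0. Qed.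

Lemma small_ndvd i : (0 < i < p)%N -> ~~ (p %| i)%N.
Proof. by move=> /andP[? ?]; rewrite gtnNdvd. Qed.

Lemma fact_ndvd i : (i < p)%N -> ~~ (p %| i`!)%N.
Proof.
elim: i => [|i IHi] lt_ip; first by rewrite gtnNdvd // prime_gt1.
by rewrite factS Euclid_dvdM // negb_or small_ndvd //= IHi // ltnW.
Qed.

Lemma bin_dvd m k : (k < p <= m)%N -> (m - k < p)%N -> (p %| 'C(m, k))%N.
Proof.
move=> /andP[lt_kp le_pm] lt_mkp.
have : (p %| 'C(m, k) * (k`! * (m - k)`!))%N.
  by rewrite bin_fact ?dvdn_fact // ltnW // (leq_trans lt_kp).
by rewrite !Euclid_dvdM // (negbTE (fact_ndvd _ lt_kp)) (negbTE (fact_ndvd _ lt_mkp)) !orbF.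
Qed.

Lemma pint_harm2 m : (m < p)%N -> pint p (harm2 m).
Proof.
move=> lt_mp; apply: pint_sum => // i /andP[_ lt_im]; rewrite -natrX.
apply: pint_natV => //; rewrite Euclid_dvdX // negb_and small_ndvd //; lia.
Qed.

(** Below 2p the only summand with p in its denominator is 1/p^2. *)
Lemma pint_harm2_large m : (p <= m < p + p)%N -> pint p (harm2 m - (p%:R ^+ 2)^-1).
Proof.
move=> /andP[le_pm lt_mp]; rewrite /harm2 (big_cat_nat (leq0n p) le_pm) big_nat_recr //=.
rewrite -/(harm2 n) addrAC addrK; apply: pintD => //; first exact: pint_harm2.
apply: pint_sum => // i /andP[le_pi lt_im]; rewrite -natrX; apply: pint_natV => //.
rewrite Euclid_dvdX // negb_and orbF -[i.+1](@subnK p) ?(leq_trans le_pi) //.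
by rewrite dvdn_addl // small_ndvd //; lia.
Qed.

(** [bin_prod] is the product of p^2/i^2 - 1 over 0 < i <= m, expanded to first order in p^2; each
    step adds an error divisible by p^4. *)
Lemma bin_prod_cong m : (m < p)%N ->
  pint p ((bin_prod n m - (-1) ^+ m * (1 - p%:R ^+ 2 * harm2 m)) / p%:R ^+ 3).
Proof.
have p0 := p_neq0.
elim: m => [|m IHm] lt_mp.
  rewrite /bin_prod !bin0 /harm2 big_nil (_ : _ / _ = 0) ?mulr0; first exact: (pint_nat _ pr_p 0).
  by ring.
have m1 := natrS_neq0 m.
have -> : (bin_prod n m.+1 - (-1) ^+ m.+1 * (1 - p%:R ^+ 2 * harm2 m.+1)) / p%:R ^+ 3 =
   (p%:R ^+ 2 * (m.+1 ^ 2)%N%:R^-1 - 1) *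
     ((bin_prod n m - (-1) ^+ m * (1 - p%:R ^+ 2 * harm2 m)) / p%:R ^+ 3)
   - (-1) ^+ m * p%:R * harm2 m * (m.+1 ^ 2)%N%:R^-1.
  rewrite bin_prodS harm2S [(-1) ^+ m.+1]exprS natrX; set q := p%:R in p0 *; move: m1.
  by rewrite -!natr1 => m1; field; rewrite m1 nat1r p0.
have pm : pint p (m.+1 ^ 2)%N%:R^-1.
  apply: pint_natV => //; rewrite Euclid_dvdX // negb_and small_ndvd //.
have pp := pint_nat _ pr_p p.
apply: (pintB _ pr_p); first apply: (pintM _ pr_p).
- apply: (pintB _ pr_p); last exact: (pint_nat _ pr_p 1).
  by apply: (pintM _ pr_p) => //; exact: pintX.
- by apply: IHm; exact: ltnW.
- apply: (pintM _ pr_p) => //; apply: (pintM _ pr_p); last exact: pint_harm2 (ltnW lt_mp).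
  apply: (pintM _ pr_p) => //.
  by apply: (pintX _ pr_p); apply: (pintN _ pr_p); exact: (pint_nat _ pr_p 1).
Qed.

Lemma wgt_sum_cong k : (k < p)%N ->
  pint p ((\sum_(0 <= m < p + p) ('C(m, k) * 'C(k, m - k))%:R * bin_prod n m -
           wgt_sum (p%:R ^+ 2) k (p + p)) / p%:R ^+ 3).
Proof.
move=> lt_kp; rewrite /wgt_sum -sumrB mulr_suml; apply: pint_sum => // m /andP[_ lt_m].
have p0 := p_neq0.
have [lt_mp|le_pm] := ltnP m p.
  rewrite /wgt (_ : _ / _ = ('C(m, k) * 'C(k, m - k))%:R *
    ((bin_prod n m - (-1) ^+ m * (1 - p%:R ^+ 2 * harm2 m)) / p%:R ^+ 3)); last by ring.
  apply: pintM => //; [exact: pint_nat | exact: bin_prod_cong].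
(* For m >= p the product is 0, so the other term must vanish modulo p^3: 1 - p^2 H_m is p^2 times a
   p-integer, and p divides C(m,k) when m <= 2k. *)
rewrite {1}/bin_prod (bin_small le_pm) mul0r mulr0 sub0r.
have [lt_km|le_mk] := ltnP (k + k) m.
  by rewrite wgt_large // mul0r oppr0 mul0r; exact: (pint_nat _ pr_p 0).
have h : pint p (harm2 m - (p%:R ^+ 2)^-1) by apply: pint_harm2_large; rewrite le_pm.
have /dvdnP[c ec] : (p %| 'C(m, k))%N by apply: bin_dvd; lia.
rewrite /wgt ec; set c' := 'C(k, m - k).
have -> : - ((-1) ^+ m * (c * p * c')%:R * (1 - p%:R ^+ 2 * harm2 m)) / p%:R ^+ 3 =
  (-1) ^+ m * (c * c')%:R * (harm2 m - (p%:R ^+ 2)^-1).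
  by rewrite !natrM; field; rewrite nat1r p0.
apply: pintM => //; apply: pintM => //; last exact: pint_nat.
by apply: pintX => //; exact: (pint_int _ pr_p (- 1)).
Qed.
End Congruence.

(** * Computations in the prime field *)

(* [hexa d] is (-1)^(d-1) (d/3). *)
Definition hexa (n : nat) : int :=
  match (n %% 6)%N with 1 | 2 => 1 | 4 | 5 => - 1 | _ => 0 end.

Lemma hexa_mod n m : hexa (n %% 6 + m) = hexa (n + m).
Proof. by rewrite /hexa modnDml. Qed.

(** This is 1 - w = w^5 for a primitive sixth root of unity w. *)
Lemma hexaS_sub n : hexa n - hexa n.+1 = hexa (n + 5).
Proof.
rewrite -[n in hexa n]addn0 -addn1 -!(hexa_mod n).
have : (n %% 6 < 6)%N by rewrite ltn_mod.
by case: (n %% 6)%N => [|[|[|[|[|[|]]]]]].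
Qed.

Lemma bin_diff_hexa k n : bin_diff hexa k n = hexa (n + 5 * k).
Proof.
elim: k n => [|k IHk] n; first by rewrite bin_diff0 muln0 addn0.
by rewrite bin_diffS !IHk addSn hexaS_sub; congr hexa; lia.
Qed.

Lemma hexa_mul5 k : hexa (5 * k) = - hexa k.
Proof.
rewrite /hexa -modnMmr; have : (k %% 6 < 6)%N by rewrite ltn_mod.
by case: (k %% 6)%N => [|[|[|[|[|[|]]]]]].
Qed.

Lemma legendre3_hexa n : legendre3 n = (-1) ^+ n.+1 * (hexa n)%:~R.
Proof.
rewrite /legendre3 /hexa -(@modn_dvdm 6 n 3) // -signr_odd /=.
have -> : odd n = odd (n %% 6) by rewrite {1}(divn_eq n 6) oddD oddM andbF.
have : (n %% 6 < 6)%N by rewrite ltn_mod.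
by case: (n %% 6)%N => [|[|[|[|[|[|]]]]]].
Qed.

(** * Binomial transforms and their fixed sequences *)

(** The value of f at 0 is never read, which admits sequences such as [f i / i%:R]. *)
Definition bin_transform {R : comPzRingType} (f : nat -> R) (n : nat) : R :=
  \sum_(0 <= k < n) (-1) ^+ k * 'C(n, k.+1)%:R * f k.+1.

Lemma bin_transform_diff (R : comPzRingType) (f : nat -> R) n :
  bin_transform f n = f 0%N - bin_diff f n 0.
Proof.
rewrite /bin_diff big_nat_recl // bin0 !mul1r opprD addrA subrr add0r -sumrN.
by apply: eq_bigr => i _; rewrite exprS; ring.
Qed.

(** Pascal's rule, with C(n,k) = (k+1)/(n+1) C(n+1,k+1) cancelling the denominator k+1. *)
Lemma bin_transform_div (F : fieldType) (f : nat -> F) n :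
  (forall i, (i < n.+1)%N -> i.+1%:R != 0 :> F) ->
  bin_transform (fun i => f i / i%:R) n.+1 =
  bin_transform (fun i => f i / i%:R) n + bin_transform f n.+1 / n.+1%:R.
Proof.
move=> nz; rewrite /bin_transform mulr_suml.
have -> : \sum_(0 <= k < n) (-1) ^+ k * 'C(n, k.+1)%:R * (f k.+1 / k.+1%:R) =
    \sum_(0 <= k < n.+1) (-1) ^+ k * 'C(n, k.+1)%:R * (f k.+1 / k.+1%:R).
  by rewrite [RHS]big_nat_recr //= bin_small // mulr0 mul0r addr0.
rewrite -big_split; apply: eq_big_nat => k /andP[_ lt_kn] /=.
have h := bin_diagR F n k; have n1 := nz n (ltnSn n); have k1 := nz k lt_kn.
have e : 'C(n.+1, k.+1)%:R = n.+1%:R * 'C(n, k)%:R / k.+1%:R :> F.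
  by apply: (canRL (mulfK k1)); rewrite h mulrC.
have e0 : 'C(n, k.+1)%:R = 'C(n.+1, k.+1)%:R - 'C(n, k)%:R :> F by rewrite binS natrD addrK.
by rewrite e0 e; field; rewrite !nat1r n1 k1.
Qed.

Lemma bin_transform_fixed_div (F : fieldType) (f : nat -> F) n :
  (forall i, (i < n)%N -> i.+1%:R != 0 :> F) ->
  (forall k, bin_transform f k.+1 = f k.+1) ->
  bin_transform (fun i => f i / i%:R) n = \sum_(0 <= k < n) f k.+1 / k.+1%:R.
Proof.
move=> nz ff; elim: n nz => [|n IHn] nz; first by rewrite /bin_transform !big_nil.
rewrite bin_transform_div // big_nat_recr //= ff IHn // => i lt_in.
by apply: nz; exact: ltnW.
Qed.

Lemma bin_transform_fixed_div2 (F : fieldType) (f : nat -> F) n :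
  (forall i, (i < n)%N -> i.+1%:R != 0 :> F) ->
  (forall k, bin_transform f k.+1 = f k.+1) ->
  bin_transform (fun i => f i / i%:R / i%:R) n =
  \sum_(0 <= k < n) (\sum_(0 <= j < k.+1) f j.+1 / j.+1%:R) / k.+1%:R.
Proof.
move=> nz ff; elim: n nz => [|n IHn] nz; first by rewrite /bin_transform !big_nil.
have /= -> := bin_transform_div _ (fun i => f i / i%:R) n nz.
rewrite big_nat_recr //=.
rewrite IHn => [|i lt_in]; last by apply: nz; exact: ltnW.
by rewrite bin_transform_fixed_div.
Qed.

Definition harmF (F : fieldType) (n : nat) : F := \sum_(0 <= i < n) i.+1%:R^-1.

Lemma harmFS (F : fieldType) n : harmF F n.+1 = harmF F n + n.+1%:R^-1.
Proof. by rewrite /harmF big_nat_recr. Qed.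

Section PrimeField.
Variables (n : nat) (pr_p : prime n.+1) (p_gt3 : (3 < n.+1)%N).
Notation p := n.+1.

Lemma Fp_neq0 i : (i < n)%N -> i.+1%:R != 0 :> 'F_p.
Proof. by move=> lt_in; rewrite Fp_natr_eq0 // small_ndvd. Qed.

Lemma Fp_opp i j : (i + j = p)%N -> i%:R = - j%:R :> 'F_p.
Proof.
by move=> e; apply/eqP; rewrite -subr_eq0 opprK -natrD e Fp_natr_eq0.
Qed.

Lemma Fp_bin_pred k : (k <= n)%N -> 'C(n, k)%:R = (-1) ^+ k :> 'F_p.
Proof.
elim: k => [|k IHk] lt_kn; first by rewrite bin0.
have := IHk (ltnW lt_kn).
have : 'C(p, k.+1)%:R = 0 :> 'F_p by apply/eqP; rewrite Fp_natr_eq0 // prime_dvd_bin.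
rewrite binS natrD => /eqP; rewrite addr_eq0 => /eqP -> ->.
by rewrite exprS mulN1r.
Qed.

Lemma sign_pred : (-1) ^+ n = 1 :> 'F_p.
Proof.
rewrite -signr_odd; have [p2|] := even_prime pr_p; last by move=> /= /negbTE ->.
by move: p_gt3; rewrite p2.
Qed.

Lemma Fp_bin_transform (f : nat -> 'F_p) :
  bin_transform f n = - \sum_(0 <= k < n) f k.+1.
Proof.
rewrite /bin_transform -sumrN; apply: eq_big_nat => k /andP[_ lt_kn].
by rewrite Fp_bin_pred // exprS mulrCA -expr2 sqrr_sign mulr1 mulN1r.
Qed.

(** Pairing j with p-j gives H_(p-1) = 0; then 1/(p-i) = -1/i peels terms off both ends. *)
Lemma Fp_harm_refl i : (i <= n)%N -> harmF 'F_p (n - i) = harmF 'F_p i.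
Proof.
have h0 : harmF 'F_p n = 0.
  have : harmF 'F_p n + harmF 'F_p n = 0.
    rewrite {2}/harmF big_nat_rev /harmF -big_split big_nat big1 //= => j lt_jn.
    by rewrite (Fp_opp j.+1 (0 + n - j.+1).+1) ?invrN ?addNr //; lia.
  rewrite -mulr2n -mulr_natl => /eqP; rewrite mulf_eq0 => /orP[|/eqP //].
  by rewrite (negbTE (Fp_neq0 1 _)) //; lia.
elim: i => [|i IHi] lt_in; first by rewrite subn0 h0 /harmF big_nil.
have := IHi (ltnW lt_in); rewrite -(subnSK lt_in) !harmFS => <-.
by rewrite (Fp_opp i.+1 (n - i.+1).+1) ?invrN ?addrK //; lia.
Qed.

(** The transform of f(i)/i^2 at p-1 is computed twice: as minus the plain sum, since C(p-1,k) =
    (-1)^k, and by [bin_transform_fixed_div2]. Summation by parts turns the latter into a sum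
    against H_(k-1); passing to H_k adds a second copy. *)
Lemma Fp_fixed_sum (f : nat -> 'F_p) :
  (forall k, bin_transform f k.+1 = f k.+1) ->
  \sum_(0 <= k < n) f k.+1 * harmF 'F_p k.+1 / k.+1%:R =
  2 * \sum_(0 <= k < n) f k.+1 / k.+1%:R / k.+1%:R.
Proof.
move=> ff; have := bin_transform_fixed_div2 _ _ _ Fp_neq0 ff; rewrite Fp_bin_transform /=.
pose A k := \sum_(0 <= j < k) f j.+1 / j.+1%:R.
have := sum_by_parts _ (harmF 'F_p) A n.
have -> : A 0%N = 0 by rewrite /A big_nil.
have -> : harmF 'F_p n = 0 by rewrite -[n in harmF _ n]subn0 Fp_harm_refl // /harmF big_nil.
rewrite mulr0 mul0r subrr sub0r.
have -> : \sum_(0 <= i < n) A i.+1 * (harmF 'F_p i.+1 - harmF 'F_p i) =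
          \sum_(0 <= k < n) A k.+1 / k.+1%:R.
  by apply: eq_bigr => i _; rewrite harmFS addrC addKr.
rewrite -/(A _) => e1 e2.
have e3 : \sum_(0 <= i < n) (A i.+1 - A i) * harmF 'F_p i = \sum_(0 <= k < n) f k.+1 / k.+1%:R / k.+1%:R.
  by rewrite e1 -e2 opprK.
rewrite mulr_natl mulr2n -{1}e3 -big_split; apply: eq_bigr => k _ /=.
have -> : A k.+1 - A k = f k.+1 / k.+1%:R by rewrite /A big_nat_recr //=; ring.
by rewrite harmFS; ring.
Qed.

Lemma harm_by_parts (F : fieldType) (m : nat) :
  2 * \sum_(0 <= k < m) harmF F k.+1 / k.+1%:R =
  harmF F m ^+ 2 + \sum_(0 <= k < m) k.+1%:R^-1 ^+ 2.
Proof.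
elim: m => [|m IHm]; first by rewrite /harmF !big_nil; ring.
by rewrite !(big_nat_recr m) //= mulrDr IHm harmFS; ring.
Qed.

(** The constant sequence 1 is fixed too. With s the sum, the sum of H_k/k is 2s, while its double
    is s because H_(p-1) = 0; hence 3s = 0. *)
Lemma Fp_inv_sqr_sum : \sum_(0 <= k < n) k.+1%:R^-1 ^+ 2 = 0 :> 'F_p.
Proof.
have f1 k : bin_transform (fun=> 1) k.+1 = 1 :> 'F_p.
  rewrite bin_transform_diff (@eq_bin_diff _ _ (fun i => 'C(i, 0)%:R)) => [|i]; last by rewrite bin0.
  by rewrite bin_diff_bin // subr0.
have h2 := Fp_fixed_sum _ f1; have h1 := harm_by_parts 'F_p n.
have h0 : harmF 'F_p n = 0 by rewrite -[n in harmF _ n]subn0 Fp_harm_refl // /harmF big_nil.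
rewrite h0 in h1.
have e1 : \sum_(0 <= k < n) 1 * harmF 'F_p k.+1 / k.+1%:R = \sum_(0 <= k < n) harmF 'F_p k.+1 / k.+1%:R.
  by apply: eq_bigr => k _; rewrite mul1r.
have e2 : \sum_(0 <= k < n) 1 / k.+1%:R / k.+1%:R = \sum_(0 <= k < n) k.+1%:R^-1 ^+ 2 :> 'F_p.
  by apply: eq_bigr => k _; rewrite mul1r.
rewrite e1 e2 in h2; rewrite h2 in h1.
set s := \sum_(0 <= k < n) _ in h1 *.
have /eqP : 3 * s = 0.
  have -> : 3 * s = 2 * (2 * s) - s by ring.
  by rewrite h1; ring.
by rewrite mulf_eq0 (negbTE (Fp_neq0 2 _)) // => /eqP.
Qed.

(* An exact division when m is prime and j.+1 < m. *)
Definition bin_quot (m j : nat) : nat := ('C(m, j.+1) %/ m)%N.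

Lemma bin_quotE j : (j < n)%N -> 'C(p, j.+1) = (p * bin_quot p j)%N.
Proof. by move=> lt_jn; rewrite mulnC divnK // prime_dvd_bin. Qed.

Lemma Fp_bin_quot j : (j < n)%N -> (bin_quot p j)%:R = (-1) ^+ j / j.+1%:R :> 'F_p.
Proof.
move=> lt_jn; apply: (canRL (mulfK (Fp_neq0 _ lt_jn))).
rewrite -Fp_bin_pred ?(ltnW lt_jn) // -natrM; congr _%:R.
apply/eqP; rewrite -(eqn_pmul2l (ltn0Sn n)) mulnA -bin_quotE // mulnC.
by rewrite -mul_bin_diag.
Qed.

(** Partial fractions: 1/(ab) = (1/a + 1/b)/L for a + b = L. *)
Lemma Fp_bin_quot_conv L : (0 < L < p)%N ->
  \sum_(0 <= j < L.-1) (bin_quot p j * bin_quot p (L - j.+2))%:R =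
  (-1) ^+ L * 2 / L%:R * harmF 'F_p L.-1.
Proof.
move=> /andP[gt0 lt_Lp].
have L0 : L%:R != 0 :> 'F_p by rewrite Fp_natr_eq0 // small_ndvd // gt0.
transitivity ((-1) ^+ L / L%:R * \sum_(0 <= j < L.-1) (j.+1%:R^-1 + (L - j.+1)%:R^-1) : 'F_p).
  rewrite mulr_sumr; apply: eq_big_nat => j /andP[_ lt_j].
  have e : (L - j.+1 = (L - j.+2).+1)%N by lia.
  rewrite natrM !Fp_bin_quot ?e; try lia.
  have -> : (-1) ^+ L = (-1) ^+ j * (-1) ^+ (L - j.+2) :> 'F_p.
    rewrite -exprD; have {1}-> : L = (j + (L - j.+2)).+2 by lia.
    by rewrite !exprS; ring.
  have j0 := Fp_neq0 j ltac:(lia); have l0 := Fp_neq0 (L - j.+2) ltac:(lia).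
  have eL : L%:R = j.+1%:R + (L - j.+2).+1%:R :> 'F_p by rewrite -natrD; congr _%:R; lia.
  by rewrite eL in L0 *; field; rewrite !nat1r j0 l0.
rewrite big_split /= -/(harmF 'F_p L.-1).
have -> : \sum_(0 <= i < L.-1) (L - i.+1)%:R^-1 = harmF 'F_p L.-1.
  rewrite big_nat_rev /harmF /=; apply: eq_big_nat => i /andP[_ lt_i].
  by congr (_%:R^-1); lia.
by ring.
Qed.

(** The convolution at L = p, where L is not invertible: here b = -a, so the terms are inverse
    squares. *)
Lemma Fp_bin_conv_sum :
  \sum_(0 <= j < n) (bin_quot p j * bin_quot p (n.-1 - j))%:R = 0 :> 'F_p.
Proof.
rewrite -[RHS]Fp_inv_sqr_sum; apply: eq_big_nat => j /andP[_ lt_jn].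
rewrite natrM !Fp_bin_quot //; last lia.
have -> : (n.-1 - j).+1%:R = - j.+1%:R :> 'F_p by apply: Fp_opp; lia.
transitivity (- ((-1) ^+ j * (-1) ^+ (n.-1 - j)) * j.+1%:R^-1 ^+ 2 : 'F_p).
  by rewrite invrN; ring.
rewrite -exprD subnKC; last lia.
have := sign_pred; case: n lt_jn => // m _ /=; rewrite exprS mulN1r => ->.
by rewrite mul1r.
Qed.
End PrimeField.

Lemma bin_transform_hexa (R : comPzRingType) k :
  bin_transform (fun i => (hexa i)%:~R) k = (hexa k)%:~R :> R.
Proof.
transitivity ((bin_transform hexa k)%:~R : R); last first.
  by rewrite bin_transform_diff bin_diff_hexa add0n hexa_mul5 opprK add0r.
rewrite /bin_transform rmorph_sum; apply: eq_bigr => i _.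
by rewrite !rmorphM rmorphXn rmorphN1 rmorph_nat.
Qed.

(** * Binomials C(2p,L) modulo p^3 *)

Section PrimeField2.
Variables (n : nat) (pr_p : prime n.+1) (p_gt3 : (3 < n.+1)%N).
Notation p := n.+1.

Definition bin_conv (L : nat) : nat :=
  \sum_(0 <= j < L.-1) bin_quot p j * bin_quot p (L - j.+2).

(** In Vandermonde's sum the two end terms are C(p,L), and each inner term has two factors divisible
    by p. *)
Lemma bin_double L : (0 < L <= p)%N ->
  'C(p + p, L) = (2 * 'C(p, L) + p ^ 2 * bin_conv L)%N.
Proof.
move=> /andP[gt0 le_Lp]; rewrite -binomial.Vandermonde.
rewrite -(big_mkord xpredT (fun i => 'C(p, i) * 'C(p, L - i)))%N.
rewrite big_nat_recr //= subnn bin0 muln1.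
case: L gt0 le_Lp => // L _ le_Lp; rewrite big_nat_recl // bin0 mul1n subn0 /bin_conv /=.
rewrite big_distrr /= addnAC addnn -mul2n; congr (_ + _)%N.
apply: eq_big_nat => j /andP[_ lt_jL].
have e : (L.+1 - j.+1 = (L - j.+1).+1)%N by lia.
rewrite e !bin_quotE //; try lia.
rewrite subSS; ring.
Qed.

Lemma even_pred : odd n = false.
Proof.
have [p2|] := even_prime pr_p; last by move=> /= /negbTE.
by move: p_gt3; rewrite p2.
Qed.

(** [hexa] is fixed by the binomial transform at p, whose top term equals [hexa p] and cancels the
    right-hand side. *)
Lemma legendre3_bin_sum :
  \sum_(0 <= d < n) legendre3 d.+1 * 'C(p, d.+1)%:R = 0.
Proof.
have := bin_transform_hexa rat p.
rewrite /bin_transform big_nat_recr //= -signr_odd even_pred binn !mul1r.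
move=> /(canRL (addrK _)); rewrite subrr => h; rewrite -[RHS]h.
by apply: eq_bigr => d _; rewrite legendre3_hexa !exprS; ring.
Qed.

(** A form of Wolstenholme's theorem: by [bin_double] the excess over 2 is p^2 times a convolution,
    which [Fp_bin_conv_sum] kills modulo p. *)
Lemma central_bin_cong : pint p (('C(p + p, p)%:R - 2) / p%:R ^+ 3).
Proof.
have /(residue0_pint _ pr_p) h : residue p (bin_conv p)%:R 0.
  have := residue_nat _ pr_p (bin_conv p).
  rewrite (_ : (bin_conv p)%:R = 0 :> 'F_p) // -[RHS](Fp_bin_conv_sum n pr_p p_gt3).
  rewrite /bin_conv natr_sum; apply: eq_big_nat => j /andP[_ lt_j].
  by congr ((_ * bin_quot _ _)%:R); lia.
rewrite bin_double ?leqnn // binn; have p0 := p_neq0 n.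
rewrite natrD !natrM (_ : _ / _ = (bin_conv p)%:R / p%:R) //.
by field; rewrite nat1r p0.
Qed.

Definition hexa_sum : 'F_p :=
  \sum_(0 <= k < n) (hexa k.+1)%:~R / k.+1%:R / k.+1%:R.

(** C(2p,p+d) = C(2p,p-d) splits by [bin_double]. The part 2 C(p,d) sums to 0; modulo p the
    convolution at p-d produces H_d, and [Fp_fixed_sum] applies to [hexa]. *)
Lemma legendre3_bin_double_sum : exists2 z : int,
  \sum_(0 <= d < n) legendre3 d.+1 * 'C(p + p, p + d.+1)%:R = p%:R ^+ 2 * z%:~R
  & z%:~R = - 4 * hexa_sum.
Proof.
exists (\sum_(0 <= d < n) (-1) ^+ d * hexa d.+1 * (bin_conv (n - d))%:R).
  rewrite rmorph_sum mulr_sumr.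
  transitivity (\sum_(0 <= d < n) (2 * (legendre3 d.+1 * 'C(p, d.+1)%:R) +
     p%:R ^+ 2 * (legendre3 d.+1 * (bin_conv (n - d))%:R))).
    apply: eq_big_nat => d /andP[_ lt_dn].
    have -> : 'C(p + p, p + d.+1) = 'C(p + p, n - d).
      by rewrite -[LHS]bin_sub; [congr (binomial _ _); lia | lia].
    rewrite bin_double; last lia.
    have -> : 'C(p, n - d) = 'C(p, d.+1) by rewrite -[RHS]bin_sub ?subSS // ltnW.
    by rewrite natrD !natrM; ring.
  rewrite big_split /= -mulr_sumr legendre3_bin_sum mulr0 add0r.
  apply: eq_bigr => d _; rewrite legendre3_hexa !exprS !rmorphM rmorphXn rmorphN1 rmorph_nat.
  by ring.
rewrite rmorph_sum /hexa_sum.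
have := Fp_fixed_sum n pr_p p_gt3 (fun i => (hexa i)%:~R) (fun k => bin_transform_hexa _ k.+1).
rewrite /= => h; rewrite (_ : 4 = 2 * 2) -?mulNr; last by ring.
rewrite -mulrA -h mulr_sumr; apply: eq_big_nat => d /andP[_ lt_dn].
rewrite !rmorphM rmorphXn rmorphN1 rmorph_nat.
rewrite /bin_conv natr_sum Fp_bin_quot_conv //; last lia.
have -> : (n - d)%:R = - d.+1%:R :> 'F_p by apply: Fp_opp => //; lia.
rewrite -subnS Fp_harm_refl //.
have -> : (-1) ^+ (n - d) = (-1) ^+ d :> 'F_p.
  rewrite -[LHS]mulr1 -[X in _ * X](sqrr_sign _ d) mulrA -exprD subnK ?(ltnW lt_dn) //.
  by rewrite -signr_odd even_pred mul1r.
rewrite invrN; set x := ssrint_intmul__canonical__GRing_RMorphism _ _.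
transitivity (((-1) ^+ d) ^+ 2 * (-2 * (x * harmF 'F_p d.+1 / d.+1%:R))); first by ring.
by rewrite sqrr_sign mul1r.
Qed.
End PrimeField2.

(** * Bernoulli numbers and polynomials *)

Lemma size_bern_seq n : size (bern_seq n) = n.+1.
Proof. by elim: n => //= n IHn; rewrite size_rcons IHn. Qed.

Lemma nth_bern_seq n k : (k <= n)%N -> nth 0 (bern_seq n) k = bernoulli k.
Proof.
elim: n => [|n IHn]; first by rewrite leqn0 => /eqP->.
rewrite leq_eqVlt => /orP[/eqP-> //|lt_kn].
by rewrite /= nth_rcons size_bern_seq lt_kn IHn.
Qed.

Lemma bernoulliS n :
  bernoulli n.+1 = - n.+2%:R^-1 * \sum_(0 <= k < n.+1) 'C(n.+2, k)%:R * bernoulli k.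
Proof.
rewrite /bernoulli /= nth_rcons size_bern_seq ltnn eqxx big_mkord; congr (_ * _).
by apply: eq_bigr => k _; rewrite -/(bernoulli k) nth_bern_seq // -ltnS.
Qed.

Lemma bernoulli_sum n :
  \sum_(0 <= k < n) 'C(n, k)%:R * bernoulli k = (n == 1%N)%:R.
Proof.
case: n => [|[|n]]; first by rewrite big_nil.
  by rewrite big_nat1 bin0 mul1r.
rewrite big_nat_recr //= bernoulliS binSn.
by rewrite mulNr mulrN mulrA divff ?natrS_neq0 // mul1r subrr.
Qed.

(** Generic in ring and coefficients, to serve over ['F_p] with reduced Bernoulli numbers. *)
Definition bern_poly {R : comPzRingType} (b : nat -> R) (m : nat) (x : R) : R :=
  \sum_(0 <= k < m.+1) 'C(m, k)%:R * b k * x ^+ (m - k).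

Lemma bin_swap m k i : ('C(m, k) * 'C(m - k, i) = 'C(m, i) * 'C(m - i, k))%N.
Proof.
have [le_m|lt_m] := leqP (k + i) m.
  have e1 := @bin_trinomial m (k + i) k; have e2 := @bin_trinomial m (k + i) i.
  rewrite addKn in e1; rewrite addnK in e2.
  rewrite -e1 ?leq_addr // -e2 ?leq_addl //; congr (_ * _)%N.
  by rewrite -[RHS]bin_sub ?leq_addl // addnK.
case: (leqP k m) (leqP i m) => [le_k|lt_k] [le_i|lt_i];
  rewrite ?(bin_small lt_k) ?(bin_small lt_i) ?muln0 ?mul0n //.
- by rewrite !(@bin_small (m - _)) ?muln0 //; lia.
- by rewrite (@bin_small (m - k)) ?muln0 //; lia.
- by rewrite (@bin_small (m - i)) ?muln0 //; lia.
Qed.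

(** Expanding (x+1)^(m-k) and exchanging sums, the coefficient of x^i becomes a sum governed by the
    recurrence for b. Only indices up to m enter, so the identity survives reduction modulo p. *)
Lemma bern_poly_diff (R : comPzRingType) (b : nat -> R) (m : nat) (x : R) :
  (forall n, (n <= m)%N -> \sum_(0 <= k < n) 'C(n, k)%:R * b k = (n == 1%N)%:R) ->
  bern_poly b m (x + 1) = bern_poly b m x + m%:R * x ^+ m.-1.
Proof.
move=> b_sum.
transitivity (\sum_(0 <= i < m.+1) 'C(m, i)%:R * x ^+ i *
   \sum_(0 <= k < m.+1) 'C(m - i, k)%:R * b k).
  transitivity (\sum_(0 <= k < m.+1) \sum_(0 <= i < m.+1)
      ('C(m, k) * 'C(m - k, i))%:R * b k * x ^+ i).
    apply: eq_big_nat => k /andP[_ lt_km].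
    rewrite addrC exprDn -(big_mkord xpredT (fun i => 1 ^+ (m - k - i) * x ^+ i *+ 'C(m - k, i))).
    rewrite mulr_sumr -(@big_nat_widen_zero _ _ (m - k).+1 m.+1) ?ltnS ?leq_subr // => [|i lt_i].
      by apply: eq_bigr => i _; rewrite expr1n mul1r natrM -mulr_natr; ring.
    by rewrite (@bin_small (m - k)) // mulr0n mulr0.
  rewrite exchange_big; apply: eq_bigr => i _; rewrite mulr_sumr.
  by apply: eq_bigr => k _; rewrite bin_swap natrM; ring.
transitivity (\sum_(0 <= i < m.+1) ('C(m, i)%:R * b (m - i)%N * x ^+ i + 
   'C(m, i)%:R * x ^+ i * (m - i == 1)%N%:R)).
  apply: eq_big_nat => i /andP[_ lt_im].
  rewrite (@big_nat_widen_zero _ _ (m - i).+1) ?ltnS ?leq_subr // => [|k lt_k]; last first.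
    by rewrite bin_small // mul0r.
  by rewrite big_nat_recr //= b_sum ?leq_subr // binn; ring.
rewrite big_split /=; congr (_ + _).
  rewrite big_nat_rev /bern_poly /=; apply: eq_big_nat => k /andP[_ lt_km].
  by rewrite add0n subSS bin_sub // subKn.
case: m {b_sum} => [|m]; first by rewrite big_nat1 mulr0 mul0r.
rewrite big_nat_recr //= subnn mulr0 addr0 big_nat_recr //= subSnn mulr1 binSn.
rewrite big_nat big1 ?add0r // => i /andP[_ lt_im].
by rewrite (_ : (m.+1 - i == 1)%N = false) ?mulr0 //; lia.
Qed.

Lemma bin_sum_inj (d : nat -> rat) :
  (forall n, \sum_(0 <= k < n) 'C(n, k)%:R * d k = 0) -> forall n, d n = 0.
Proof.
move=> d_sum n; elim/ltn_ind: n => n IHn.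
have := d_sum n.+1; rewrite big_nat_recr //= big_nat big1 ?add0r => [|k /andP[_ /IHn->]];
  last by rewrite mulr0.
by rewrite binSn => /eqP; rewrite mulf_eq0 (negbTE (natrS_neq0 n)) => /eqP.
Qed.

(** This is (-1)^n B_n(1) = B_n. Binomial inversion shows that the defect solves the homogeneous
    recurrence of [bin_sum_inj]. *)
Lemma bernoulli_parity n : (-1) ^+ n * (bernoulli n + (n == 1%N)%:R) = bernoulli n.
Proof.
apply/eqP; rewrite -subr_eq0; apply/eqP; move: n.
apply: (bin_sum_inj (fun n => _ - _)) => n.
(* This is B_i(1) for i <= n; the common bound makes it a combination of the C(i,k) with
   coefficients independent of i. *)
pose beta i := \sum_(0 <= k < n.+1) 'C(i, k)%:R * bernoulli k.
have betaE i : (i <= n)%N -> beta i = bernoulli i + (i == 1%N)%:R.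
  move=> le_in; rewrite /beta (@big_nat_widen_zero _ _ i.+1) // => [|k lt_k]; last first.
    by rewrite bin_small // mul0r.
  by rewrite big_nat_recr //= binn mul1r bernoulli_sum addrC.
have h : bin_diff beta n 0 = (-1) ^+ n * bernoulli n.
  rewrite /bin_diff.
  transitivity (\sum_(0 <= k < n.+1) bin_diff (fun i => 'C(i, k)%:R) n 0 * bernoulli k).
    rewrite /bin_diff; under [RHS]eq_bigr => k _ do rewrite mulr_suml.
    rewrite exchange_big; apply: eq_bigr => i _; rewrite mulr_sumr.
    by apply: eq_bigr => k _ /=; ring.
  rewrite big_nat_recr //= big_nat big1 => [|k /andP[_ lt_kn]]; last by rewrite bin_diff_bin ?mul0r.
  rewrite add0r /bin_diff big_nat_recr //= big_nat big1 => [|k /andP[_ lt_kn]]; last first.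
    by rewrite (@bin_small (0 + k)) ?mulr0.
  by rewrite !binn add0r !mulr1.
under eq_bigr => k _ do rewrite mulrBr.
rewrite sumrB bernoulli_sum.
move: h; rewrite /bin_diff big_nat_recr //= binn mulr1 betaE // => h.
have -> : \sum_(0 <= i < n) 'C(n, i)%:R * ((-1) ^+ i * (bernoulli i + (i == 1%N)%:R)) =
   (-1) ^+ n * bernoulli n - (-1) ^+ n * (bernoulli n + (n == 1%N)%:R).
  rewrite -h addrK; apply: eq_big_nat => i /andP[_ lt_in]; rewrite add0n betaE; first by ring.
  exact: ltnW.
by case: eqVneq => [->|_] /=; ring.
Qed.

Lemma bernoulli_odd n : odd n -> (1 < n)%N -> bernoulli n = 0.
Proof.
move=> odd_n gt1; have := bernoulli_parity n.
rewrite -signr_odd odd_n gtn_eqF // addr0; lra.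
Qed.

(** * B_{p-2} as a function on the prime field *)

Section BernoulliModP.
Variables (n : nat) (pr_p : prime n.+1) (p_gt3 : (3 < n.+1)%N).
Notation p := n.+1.
Notation m := n.-1.

(** The recurrence for B_k divides only by k+1 < p. *)
Lemma pint_bernoulli k : (k < n)%N -> pint p (bernoulli k).
Proof.
elim/ltn_ind: k => -[|k] IHk lt_kn; first exact: (pint_nat _ pr_p 1).
rewrite bernoulliS; apply: (pintM _ pr_p).
  by apply: (pintN _ pr_p); apply: (pint_natV _ pr_p); apply: small_ndvd => //.
apply: (pint_sum _ pr_p) => i /andP[_ lt_ik]; apply: (pintM _ pr_p); first exact: pint_nat.
by apply: IHk => //; apply: ltn_trans lt_kn.
Qed.

Lemma redF_bernoulli_sum k : (k <= m)%N ->
  \sum_(0 <= i < k) 'C(k, i)%:R * redF p (bernoulli i) = (k == 1%N)%:R.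
Proof.
move=> le_km; apply: (residue_inj _ pr_p _ _ _ _ (residue_nat _ pr_p _)).
rewrite -bernoulli_sum; apply: (residue_sum _ pr_p) => i /andP[_ lt_ik].
apply: (residueM _ pr_p); first exact: residue_nat.
by apply: redFP => //; apply: pint_bernoulli; lia.
Qed.

Definition bernF : 'F_p -> 'F_p := bern_poly (fun k => redF p (bernoulli k)) m.

Lemma residue_bernpoly x y :
  residue p x y -> residue p (bernpoly m x) (bernF y).
Proof.
move=> xy; rewrite /bernpoly -(big_mkord xpredT (fun k => 'C(m, k)%:R * bernoulli k * x ^+ (m - k))).
apply: (residue_sum _ pr_p) => i /andP[_ lt_i].
apply: (residueM _ pr_p); last exact: residueX.
apply: (residueM _ pr_p); first exact: residue_nat.
by apply: redFP => //; apply: pint_bernoulli; lia.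
Qed.

Lemma Fp_expp (x : 'F_p) : x ^+ p = x.
Proof.
rewrite -[LHS](natr_Zp (x ^+ p)) -{1}[x]natr_Zp -natrX natr_Zp.
by rewrite -(Fp_nat_mod pr_p) fermat_little // (Fp_nat_mod pr_p) natr_Zp.
Qed.

(* The junk value [0^-1 = 0] makes this hold at [x = 0] as well. *)
Lemma bernF_diff x : bernF (x + 1) = bernF x - 2 * x^-1 ^+ 2.
Proof.
rewrite /bernF bern_poly_diff; last exact: redF_bernoulli_sum.
have -> : m%:R = - 2 :> 'F_p by apply: Fp_opp => //; lia.
rewrite mulNr; congr (_ - _ * _).
have [->|x0] := eqVneq x 0; first by rewrite invr0 !expr0n; case: n p_gt3 => [|[|[|]]].
(* The exponent is p-3, and x^(p-3) x^3 = x by Fermat. *)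
apply: (mulIf (expf_neq0 3 x0)); rewrite -exprD.
have -> : (n.-2 + 3 = p)%N by lia.
by rewrite Fp_expp; field.
Qed.

(** The constant term is B_{p-2}, with p-2 odd and at least 3. *)
Lemma bernF0 : bernF 0 = 0.
Proof.
rewrite /bernF /bern_poly big_nat_recr //= subnn mulr1 binn mul1r big_nat big1 ?add0r => [|i /andP[_ lt_im]].
  rewrite bernoulli_odd /redF ?mul0r //; last lia.
  by have := even_pred n pr_p p_gt3; case: n p_gt3 => //= k _ /negbFE.
by rewrite expr0n subn_eq0 leqNgt lt_im mulr0.
Qed.

Lemma periodic_const (f : 'F_p -> 'F_p) x : (forall y, f (y + 1) = f y) -> f x = f 0.
Proof.
move=> per; rewrite -[x]natr_Zp; elim: (x : nat) => [//|k IHk].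
by rewrite -natr1 per.
Qed.

(** [bernF (1 - y) + bernF y] has period 1, hence is constant on ['F_p], and it vanishes at 0. *)
Lemma bernF_refl x : bernF (1 - x) = - bernF x.
Proof.
apply/eqP; rewrite -subr_eq0 opprK; apply/eqP.
rewrite (periodic_const (fun y => bernF (1 - y) + bernF y)) => [|y].
  by rewrite subr0 -[1]add0r bernF_diff bernF0 invr0; ring.
have := bernF_diff (- y); rewrite [- y + 1]addrC => ->.
have -> : 1 - (y + 1) = - y by ring.
by rewrite bernF_diff invrN; ring.
Qed.

Lemma Fp2_neq0 : 2 != 0 :> 'F_p.
Proof. by apply: (Fp_neq0 n pr_p 1); lia. Qed.
Lemma Fp3_neq0 : 3 != 0 :> 'F_p.
Proof. by apply: (Fp_neq0 n pr_p 2); lia. Qed.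

Lemma Fp_eq_opp (x : 'F_p) : x = - x -> x = 0.
Proof.
move=> xN; have /eqP : 2 * x = 0 by rewrite mulr_natl mulr2n {1}xN addNr.
by rewrite mulf_eq0 (negbTE Fp2_neq0) => /eqP.
Qed.

(** The classical factor 2^(1-m) with m = p-2 is 4 in ['F_p]. Both sides change equally under x ->
    x+1 and agree at 0, where B(1/2) = 0 by reflection. *)
Lemma bernF_double x : 4 * bernF (2 * x) = bernF x + bernF (x + 2^-1).
Proof.
have p2 := Fp2_neq0.
have invM y : (2 * y)^-1 ^+ 2 = y^-1 ^+ 2 / 4 :> 'F_p.
  have -> : 4^-1 = 2^-1 ^+ 2 :> 'F_p by rewrite exprVn; congr _^-1; ring.
  by rewrite invfM; ring.
have half0 : bernF 2^-1 = 0.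
  by apply: Fp_eq_opp; rewrite -bernF_refl; congr bernF; field.
apply/eqP; rewrite -subr_eq0; apply/eqP.
rewrite (periodic_const (fun y => 4 * bernF (2 * y) - (bernF y + bernF (y + 2^-1)))) => [|y].
  by rewrite mulr0 add0r half0 bernF0; ring.
have -> : 2 * (y + 1) = 2 * y + 1 + 1 by ring.
have -> : y + 1 + 2^-1 = y + 2^-1 + 1 by ring.
rewrite !bernF_diff invM.
have -> : 2 * y + 1 = 2 * (y + 2^-1) by field.
rewrite invM.
have f4 : 4 != 0 :> 'F_p by rewrite (_ : 4 = 2 * 2) ?mulf_neq0 //; ring.
by move: (y^-1 ^+ 2) ((y + 2^-1)^-1 ^+ 2) => u v; field; rewrite ?p2 ?f4.
Qed.

(** As B(d/6+1) - B(d/6) = -72/d^2, weighting by [hexa] and telescoping expresses the sum through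
    the values B(i/6), all multiples of B(1/3). *)
Lemma hexa_sum_bernF : 12 * hexa_sum n = bernF 3^-1.
Proof.
have p2 := Fp2_neq0; have p3 := Fp3_neq0.
have p6 : 6 != 0 :> 'F_p by rewrite (_ : 6 = 2 * 3) ?mulf_neq0 //; ring.
pose G d : 'F_p := (hexa d)%:~R * bernF (d%:R / 6).
(* Telescoping with step 6 leaves six terms at each end. *)
have shift (k : nat) : \sum_(0 <= d < k) (G (d + 6)%N - G d) =
    \sum_(0 <= i < 6) (G (k + i)%N - G i).
  elim: k => [|k IHk]; first by rewrite big_nil big1 // => i _; rewrite subrr.
  rewrite big_nat_recr //= IHk !big_nat_recr //= !big_nil !addSn !addnS !addn0; ring.
have hexa6 d : hexa (d + 6) = hexa d by rewrite /hexa modnDr.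
have e1 : \sum_(0 <= d < p) (G (d + 6)%N - G d) = - 72 * hexa_sum n.
  rewrite big_nat_recl // {1 2}/G hexa6 !mul0r subrr add0r /hexa_sum mulr_sumr.
  apply: eq_big_nat => d /andP[_ lt_dn].
  rewrite /G hexa6 natrD mulrDl divff // bernF_diff invfM invrK.
  ring.
have b0 := bernF0.
have b3 : bernF (3 / 6) = 0.
  by apply: Fp_eq_opp; rewrite -bernF_refl; congr bernF; field; rewrite ?p2 ?p3 ?p6.
have b2 : bernF (2 / 6) = bernF 3^-1 by congr bernF; field; rewrite ?p2 ?p3 ?p6.
have b4 : bernF (4 / 6) = - bernF 3^-1.
  by rewrite -bernF_refl; congr bernF; field; rewrite ?p2 ?p3 ?p6.
have b5 : bernF (5 / 6) = - bernF (1 / 6).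
  by rewrite -bernF_refl; congr bernF; field; rewrite ?p2 ?p3 ?p6.
(* Duplication at 1/6: 4 B(1/3) = B(1/6) + B(2/3) = B(1/6) - B(1/3). *)
have b1 : bernF (1 / 6) = 5 * bernF 3^-1.
  have := bernF_double (1 / 6).
  have -> : 2 * (1 / 6) = 3^-1 :> 'F_p by field; rewrite ?p2 ?p3 ?p6.
  have -> : 1 / 6 + 2^-1 = 4 / 6 :> 'F_p by field; rewrite ?p2 ?p3 ?p6.
  rewrite b4 => h; transitivity (4 * bernF 3^-1 + bernF 3^-1); last by ring.
  by rewrite h; ring.
(* In ['F_p] the argument (p+i)/6 is i/6, while [hexa] retains p mod 6. *)
have Gp i : G (p + i)%N = (hexa (p %% 6 + i))%:~R * bernF (i%:R / 6).
  by rewrite /G hexa_mod natrD (Fp_opp n pr_p p 0) ?addn0 // oppr0 add0r.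
have p_mod : (p %% 6 = 1 \/ p %% 6 = 5)%N.
  have n2 : ~~ (2 %| p)%N by rewrite dvdn_prime2 //; lia.
  have n3 : ~~ (3 %| p)%N by rewrite dvdn_prime2 //; lia.
  lia.
apply: (mulfI p6); transitivity (- (- 72 * hexa_sum n)); first by ring.
rewrite -e1 shift !big_nat_recr //= big_nil !Gp /G !mul0r b0 b5 b1 b2 b3 b4.
by case: p_mod => ->; rewrite /hexa /= ?mul0r; ring.
Qed.
End BernoulliModP.

(** * The congruence *)

Section Assembly.
Variables (n : nat) (pr_p : prime n.+1) (p_gt3 : (3 < n.+1)%N).
Notation p := n.+1.
Notation c := ('C(p + p, p)%:R : rat).

Definition bin_prod_sum (l : nat) : rat :=
  \sum_(0 <= m < p + p) ('C(m, l) * 'C(l, m - l))%:R * bin_prod n m.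

(** Only m = p-1 survives between C(m,p-1) and C(p-1,m), leaving C(2p-1,p-1). *)
Lemma bin_prod_sum_last : bin_prod_sum n = c / 2.
Proof.
rewrite /bin_prod_sum (bigD1_seq n) ?iota_uniq //=; last by rewrite mem_index_iota; lia.
rewrite binn subnn bin0 mul1r big1_seq ?addr0 => [|m /andP[ne_mn _]]; last first.
  have [lt_mn|] := ltnP m n; first by rewrite bin_small // mul0r.
  rewrite leq_eqVlt eq_sym (negbTE ne_mn) /= => lt_nm.
  by rewrite /bin_prod (@bin_small n m) // mul0r mulr0.
rewrite /bin_prod binn mul1r addnS binS natrD -(@bin_sub (p + n) n) ?leq_addl // addnK.
by field.
Qed.

Lemma double_bin_dvd d : (d < n)%N -> (p %| 'C(p + p, p + d.+1))%N.
Proof.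
move=> lt_dn; rewrite -bin_sub; last lia.
rewrite (_ : (p + p - (p + d.+1) = n - d)%N); last lia.
rewrite bin_double //; last lia.
apply: dvdn_add; last by rewrite expnS -mulnA dvdn_mulr.
by apply: dvdn_mull; apply: prime_dvd_bin => //; lia.
Qed.

Lemma central_bin_ndvd : ~~ (p %| 'C(p + p, p))%N.
Proof.
rewrite bin_double ?leqnn // binn dvdn_addl; last by rewrite expnS -mulnA dvdn_mulr.
by rewrite gtnNdvd //; lia.
Qed.

Lemma pint_inv2 : pint p 2^-1.
Proof. by apply: (pint_natV _ pr_p 2); rewrite gtnNdvd //; lia. Qed.

Lemma pint_legendre3 k : pint p (legendre3 k).
Proof.
rewrite legendre3_hexa -(rmorphN1 (intr : int -> rat)) -rmorphXn -rmorphM; exact: pint_int.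
Qed.

(** In ['F_p], y/2 = -2 [hexa_sum] = -B(1/3)/6 by [hexa_sum_bernF]. *)
Lemma residue_sum_bern (y : int) : y%:~R = - 4 * hexa_sum n ->
  pint p ((y%:~R / 2 + bernpoly n.-1 (1 / 3) / 6) / p%:R).
Proof.
move=> ey; apply: (residue0_pint _ pr_p).
have n2 : ~~ (p %| 2)%N by rewrite gtnNdvd //; lia.
have n3 : ~~ (p %| 3)%N by rewrite gtnNdvd //; lia.
have n6 : ~~ (p %| 6)%N by rewrite (_ : 6 = 2 * 3)%N // Euclid_dvdM // negb_or n2.
have r3 : residue p (1 / 3) 3^-1 by rewrite mul1r; exact: residue_natV.
have -> : 0 = y%:~R / 2%:R + bernF n 3^-1 / 6%:R :> 'F_p.
  rewrite -hexa_sum_bernF // ey.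
  have p2 : 2 != 0 :> 'F_p := Fp2_neq0 n pr_p p_gt3.
  have p6 : 6 != 0 :> 'F_p by rewrite Fp_natr_eq0.
  by field; rewrite p2 p6.
apply: (residueD _ pr_p); apply: (residueM _ pr_p); try exact: residue_natV.
  exact: residue_int.
exact: residue_bernpoly.
Qed.
End Assembly.

Theorem theorem1p1 (p : nat) : prime p -> (3 < p)%N ->
  ratcong p 3
    ((p%:R)^-1 * \sum_(0 <= k < p) (-1) ^+ k * (2 * k + 1)%:R * (apery k)%:R)
    (legendre3 p + (p%:R) ^+ 2 / 6%:R * bernpoly (p - 2) (1 / 3%:R)).
Proof.
case: p => // n pr_p p_gt3.
have p0 : n.+1%:R != 0 :> rat := p_neq0 n.
have pN := pint_nat _ pr_p; have inv2 := pint_inv2 n pr_p p_gt3.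
rewrite /ratcong -/(pint _ _) apery_sum; last by rewrite /= even_pred.
set S := \sum_(0 <= l < _) _.
have S_cong : pint n.+1 ((S -
    \sum_(0 <= l < n.+1) 'C(l + l, l)%:R * wgt_sum (n.+1%:R ^+ 2) l (n.+1 + n.+1)) / n.+1%:R ^+ 3).
  rewrite /S -sumrB mulr_suml; apply: (pint_sum _ pr_p) => l /andP[_ lt_lp].
  by rewrite -mulrBr -mulrA; apply: (pintM _ pr_p) => //; exact: wgt_sum_cong.
have := wgt_sum_cong n pr_p n (ltnSn n).
rewrite -/(bin_prod_sum n n) bin_prod_sum_last // => W_cong.
have C_cong := central_bin_cong n pr_p p_gt3.
have invC : pint n.+1 'C(n.+1 + n.+1, n.+1)%:R^-1.
  by apply: pint_natV => //; exact: central_bin_ndvd.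
have C0 := central_bin_neq0 n.+1.
have [y z_y y_X] := legendre3_bin_double_sum n pr_p p_gt3.
have B_cong := residue_sum_bern n pr_p p_gt3 y y_X.
(* [T] is divisible by p, so p^2 [T] drops out modulo p^3. *)
pose T := \sum_(0 <= d < n) legendre3 d.+1 / d.+1%:R ^+ 2 * 'C(n.+1 + n.+1, n.+1 + d.+1)%:R : rat.
have T_cong : pint n.+1 (T / n.+1%:R).
  rewrite mulr_suml; apply: (pint_sum _ pr_p) => d /andP[_ lt_dn].
  have /dvdnP[q ->] := double_bin_dvd n pr_p p_gt3 d lt_dn.
  rewrite natrM -mulrA mulfK // -natrX; apply: (pintM _ pr_p) => //; apply: (pintM _ pr_p).
    exact: pint_legendre3.
  by apply: (pint_natV _ pr_p); rewrite Euclid_dvdX // negb_and small_ndvd //.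
move: S_cong; rewrite weighted_central_bin_sum // z_y.
have -> : \sum_(0 <= d < n) legendre3 d.+1 * (n.+1%:R ^+ 2 / d.+1%:R ^+ 2 - 1) *
    'C(n.+1 + n.+1, n.+1 + d.+1)%:R = n.+1%:R ^+ 2 * T - n.+1%:R ^+ 2 * y%:~R.
  rewrite -z_y /T mulr_sumr -sumrB; apply: eq_bigr => d _; ring.
move: W_cong C_cong invC C0 => W_cong C_cong invC C0.
set w := wgt_sum _ _ _ in W_cong *; set c := 'C(_, _)%:R in W_cong C_cong invC C0 *.
set x := legendre3 _; set b := bernpoly _ _ in B_cong *.
rewrite subSS -/n.-1 subn1 -/b => S_cong.
(* [w] is u_(p-1), congruent to c/2 and hence to 1. *)
have W1 : pint n.+1 ((w - 1) / n.+1%:R ^+ 3).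
  rewrite (_ : _ / _ = (c - 2) / n.+1%:R ^+ 3 * 2^-1 - (c / 2 - w) / n.+1%:R ^+ 3);
    last by field; rewrite nat1r p0.
  by apply: (pintB _ pr_p) => //; apply: (pintM _ pr_p).
set q := n.+1%:R in p0 *.
(* With [w] = 1 and [c] = 2 modulo p^3, [S] becomes x + p^2 y - (3/2) p^2 y = x - p^2 y/2, and y/2 =
   -b/6 modulo p. Each summand below is one of these errors. *)
have -> : (S - (x + q ^+ 2 / 6%:R * b)) / q ^+ 3 =
  (S - (w * (x + q ^+ 2 * y%:~R) + 3 / c * (q ^+ 2 * T - q ^+ 2 * y%:~R))) / q ^+ 3
  + (w - 1) / q ^+ 3 * (x + q ^+ 2 * y%:~R) + 3 * c^-1 * (T / q)
  + 3 * q ^+ 2 * y%:~R * 2^-1 * c^-1 * ((c - 2) / q ^+ 3)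
  - (y%:~R / 2 + b / 6) / q.
  by field; rewrite C0 nat1r p0.
have py := pint_int _ pr_p y; have p3 := pN 3; have pq := pN n.+1.
have px := pint_legendre3 n pr_p n.+1.
have pq2 := pintX _ pr_p _ 2 pq.
apply: (pintB _ pr_p) => //; apply: (pintD _ pr_p).
  apply: (pintD _ pr_p); first apply: (pintD _ pr_p) => //; repeat (apply: (pintM _ pr_p) => //).
  by apply: (pintD _ pr_p) => //; apply: (pintM _ pr_p).
by repeat (apply: (pintM _ pr_p) => //).
Qed.
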